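(* Let $(M^m,g)$ be a compact connected orientable Riemannian manifold without boundary, and let $(N^n,h,\xi,\lambda)$ be a non-trivial Ricci soliton. Assume that $$\operatorname{Ric}^{N}>\lambda h\quad\text{(everywhere on } N)\qquad\text{or}\qquad \operatorname{Ric}^{N}<\lambda h\quad\text{(everywhere on } N).$$ Then any symphonic map $\varphi:(M^m,g)\to(N^n,h)$ is constant.
   Context: All manifolds are smooth and without boundary, and maps are smooth. Repeated indices are summed, and $\{e_i\}_{i=1}^m$ denotes a local orthonormal frame on $(M^m,g)$. Symphonic maps: for a smooth map $\varphi:(M^m,g)\to(N^n,h)$, the symphonic energy is $E_{sym}(\varphi)=\int_M |\varphi^*h|^2\,dv_g$, where $|\varphi^*h|^2=\sum_{i,j} h(d\varphi(e_i),d\varphi(e_j))^2$. The map $\varphi$ is called symphonic if it is a critical point of $E_{sym}$. Equivalently, with the $\varphi^{-1}TN$-valued 1-form $$\sigma_\varphi(X)=\sum_j h(d\varphi(X),d\varphi(e_j))\,d\varphi(e_j),\qquad X\in\Gamma(TM),$$ $\varphi$ is symphonic if and only if $\tau^s(\varphi):=\operatorname{div}_g\sigma_\varphi=0$, where $$\operatorname{div}_g\sigma_\varphi=\sum_{i,j}\Big[h(\nabla d\varphi(e_i,e_i),d\varphi(e_j))\,d\varphi(e_j)+h(d\varphi(e_i),\nabla d\varphi(e_i,e_j))\,d\varphi(e_j)+h(d\varphi(e_i),d\varphi(e_j))\,\nabla d\varphi(e_i,e_j)\Big],$$ and $\nabla d\varphi$ is the second fundamental form of $\varphi$. Ricci soliton: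 $(N^n,h,\xi,\lambda)$ is a Ricci soliton if $(N^n,h)$ is a Riemannian manifold, $\xi$ is a smooth vector field on $N$, $\lambda\in\mathbb{R}$ is a constant, and $\operatorname{Ric}^{N}+\tfrac12\mathfrak{L}_\xi h=\lambda h$, where $\operatorname{Ric}^N$ is the Ricci curvature of $(N,h)$ and $\mathfrak{L}$ denotes the Lie derivative. It is called non-trivial if $(N,h)$ is not Einstein. For symmetric 2-tensors $A,B$ on $N$, $A>B$ means $A(v,v)>B(v,v)$ for every nonzero tangent vector $v$ of $N$; similarly for $A<B$. *)

(* Defs.v *)
From mathcomp Require Import all_boot all_order all_algebra.
From mathcomp Require Import all_classical all_reals all_analysis.
Set Implicit Arguments.
Unset Strict Implicit.
Unset Printing Implicit Defensive.
Import Order.TTheory GRing.Theory Num.Theory.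
Import numFieldNormedType.Exports.
Local Open Scope classical_set_scope.
Local Open Scope ring_scope.

(* Conventions.  Coordinates are row vectors: for a local map f, the Jacobian
   ['J f u] acts on the right, so df_u (v) = v *m 'J f u.  A tensor field is
   given by its components in every chart of the (maximal) atlas, as functions
   of the coordinates u, related by the usual transformation law; only the
   values at coordinates u in the image of the chart are meaningful.  A
   covariant 2-tensor A is evaluated on v as (v *m A u *m v^T) 0 0. *)

(* C^oo on the open set U: every iterated directional derivative of f exists
   and is continuous at every point of U. *)
Definition smooth_on (R : realType) (V W : normedModType R) (U : set V)
    (f : V -> W) : Prop :=
  forall (ws : seq V) (v x : V), U x ->
    let F := foldr (fun w G => 'D_w G) f ws in
    {for x, continuous F} /\ derivable F x v.

(* Integral over R^n as an iterated one-dimensional Lebesgue integral (for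
   nonnegative Borel functions this is the integral against n-dimensional
   Lebesgue measure, by Tonelli's theorem). *)
Fixpoint integral_rV (R : realType) (n : nat) :
    ('rV[R]_n -> \bar R) -> \bar R :=
  match n with
  | 0%N => fun f => f 0
  | k.+1 => fun f => (\int[@lebesgue_measure R]_x
      integral_rV (fun v : 'rV[R]_k =>
        f (row_mx (x%:M : 'rV[R]_1) v : 'rV[R]_k.+1)))%E
  end.

Section Manifolds.
Variables (R : realType) (m : nat) (M : topologicalType).

(* [coord] and [param] are total functions; they are mutually inverse
   homeomorphisms between [dom] and the image of [dom], and their values
   elsewhere are irrelevant. *)
Record chart := Chart {
  dom : set M;
  coord : M -> 'rV[R]_m;
  param : 'rV[R]_m -> M;
  open_dom : open dom;
  open_img : open (coord @` dom);
  coordK : forall p, dom p -> param (coord p) = p;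
  coord_continuous : forall p, dom p -> {for p, continuous coord};
  param_continuous : forall u, (coord @` dom) u -> {for u, continuous param}
}.

Definition img (c : chart) : set 'rV[R]_m := coord c @` dom c.

Definition transition (c d : chart) : 'rV[R]_m -> 'rV[R]_m :=
  coord d \o param c.

Definition overlap (c d : chart) : set 'rV[R]_m :=
  coord c @` (dom c `&` dom d).

Definition compatible (c d : chart) : Prop :=
  smooth_on (overlap c d) (transition c d) /\
  smooth_on (overlap d c) (transition d c).

Record smooth_manifold := SmoothManifold {
  atlas : set chart;
  atlas_cover : forall p, exists2 c, atlas c & dom c p;
  atlas_compatible : forall c d, atlas c -> atlas d -> compatible c d;
  atlas_maximal :
    forall c, (forall d, atlas d -> compatible c d) -> atlas c;
  manifold_hausdorff : hausdorff_space M;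
  manifold_second_countable : @second_countable M
}.

Variable S : smooth_manifold.

Definition chart_at (p : M) : chart := s2val (cid2 (atlas_cover S p)).

Definition orientable : Prop :=
  exists B : set chart,
    [/\ B `<=` atlas S,
        forall p, exists2 c, B c & dom c p
      & forall c d, B c -> B d -> forall u, overlap c d u ->
          0 < \det ('J (transition c d) u)].

Record riemannian_metric := RiemannianMetric {
  metric :> chart -> 'rV[R]_m -> 'M[R]_m;
  metric_smooth : forall c, atlas S c -> smooth_on (img c) (metric c);
  metric_sym : forall c u, atlas S c -> img c u -> (metric c u)^T = metric c u;
  metric_pos : forall c u (v : 'rV[R]_m), atlas S c -> img c u -> v != 0 ->
    0 < (v *m metric c u *m v^T) 0 0;
  metric_change : forall c d u, atlas S c -> atlas S d -> overlap c d u ->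
    metric c u = 'J (transition c d) u *m metric d (transition c d u)
                   *m ('J (transition c d) u)^T
}.

Record vector_field := VectorField {
  field :> chart -> 'rV[R]_m -> 'rV[R]_m;
  field_smooth : forall c, atlas S c -> smooth_on (img c) (field c);
  field_change : forall c d u, atlas S c -> atlas S d -> overlap c d u ->
    field d (transition c d u) = field c u *m 'J (transition c d) u
}.

Definition partial (k : 'I_m) (f : 'rV[R]_m -> R) (u : 'rV[R]_m) : R :=
  'D_(delta_mx 0 k) (f : 'rV[R]_m -> R^o) u.

(* Gamma^k_{ij} *)
Definition christoffel (g : riemannian_metric) (c : chart) (k i j : 'I_m)
    (u : 'rV[R]_m) : R :=
  2^-1 * \sum_l invmx (g c u) k l *
    (partial i (fun w => g c w j l) u + partial j (fun w => g c w i l) u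
     - partial l (fun w => g c w i j) u).

(* Component along d_l of R(d_i, d_j) d_k, where
   R(X, Y) Z = D_X D_Y Z - D_Y D_X Z - D_[X, Y] Z. *)
Definition riemann (g : riemannian_metric) (c : chart) (l k i j : 'I_m)
    (u : 'rV[R]_m) : R :=
  partial i (christoffel g c l j k) u - partial j (christoffel g c l i k) u
  + \sum_p (christoffel g c l i p u * christoffel g c p j k u
            - christoffel g c l j p u * christoffel g c p i k u).

(* Ric(Y, Z) = trace (X |-> R(X, Y) Z) *)
Definition ricci (g : riemannian_metric) (c : chart) (u : 'rV[R]_m) :
    'M[R]_m :=
  \matrix_(j, k) \sum_i riemann g c i k i j u.

Definition lie_metric (xi : vector_field) (g : riemannian_metric) (c : chart)
    (u : 'rV[R]_m) : 'M[R]_m :=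
  \matrix_(i, j) \sum_k
    (xi c u 0 k * partial k (fun w => g c w i j) u
     + g c u k j * partial i (fun w => xi c w 0 k) u
     + g c u i k * partial j (fun w => xi c w 0 k) u).

Definition ricci_soliton (g : riemannian_metric) (xi : vector_field)
    (lambda : R) : Prop :=
  forall c u, atlas S c -> img c u ->
    ricci g c u + 2^-1 *: lie_metric xi g c u = lambda *: g c u.

Definition einstein (g : riemannian_metric) : Prop :=
  exists a : R, forall c u, atlas S c -> img c u -> ricci g c u = a *: g c u.

Definition tensor_lt (A B : chart -> 'rV[R]_m -> 'M[R]_m) : Prop :=
  forall c u (v : 'rV[R]_m), atlas S c -> img c u -> v != 0 ->
    (v *m A c u *m v^T) 0 0 < (v *m B c u *m v^T) 0 0.

(* Some matrix whose rows form a G-orthonormal basis; one exists when G is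
   symmetric positive definite. *)
Definition orthonormal_frame (G : 'M[R]_m) : 'M[R]_m :=
  xget 0 [set E : 'M[R]_m | E *m G *m E^T = 1%:M].

End Manifolds.

Notation borel M := (g_sigma_algebraType (@open M)).

(* Characterizes the Riemannian measure dv_g: it is the unique Borel measure
   given by sqrt(det g) du in every chart. *)
Definition is_riemannian_measure (R : realType) (m : nat)
    (M : ptopologicalType) (SM : smooth_manifold R m M)
    (g : riemannian_metric SM) (dv : {measure set (borel M) -> \bar R}) :
    Prop :=
  forall (c : chart R m M) (A : set (borel M)),
    atlas SM c -> measurable A -> A `<=` dom c ->
    dv A = integral_rV (fun u =>
      (Num.sqrt (\det (g c u)) * \1_(coord c @` A) u)%:E).

Section Maps.
Variables (R : realType) (m n : nat) (M : ptopologicalType)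
  (N : topologicalType) (SM : smooth_manifold R m M)
  (SN : smooth_manifold R n N).

Definition local_rep (phi : M -> N) (c : chart R m M) (d : chart R n N) :
    'rV[R]_m -> 'rV[R]_n :=
  coord d \o phi \o param c.

Definition smooth_map (phi : M -> N) : Prop :=
  continuous phi /\
  forall c d, atlas SM c -> atlas SN d ->
    smooth_on (img c `&` [set u | dom d (phi (param c u))])
      (local_rep phi c d).

(* Phi is a smooth map on the manifold M x ]-e, e[ with Phi(-, 0) = phi. *)
Definition smooth_variation (phi : M -> N) (e : R) (Phi : M -> R -> N) :
    Prop :=
  [/\ 0 < e,
      forall p, Phi p 0 = phi p,
      forall (p : M) (t : R), `|t| < e ->
        {for (p, t), continuous (fun z : M * R => Phi z.1 z.2)}
    & forall c d, atlas SM c -> atlas SN d ->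
        smooth_on
          [set z : 'rV[R]_m * R^o | [/\ img c z.1, `|z.2| < e
             & dom d (Phi (param c z.1) z.2)]]
          (fun z : 'rV[R]_m * R^o => coord d (Phi (param c z.1) z.2))].

Variables (g : riemannian_metric SM) (h : riemannian_metric SN).

(* |phi^* h|^2 = sum_{i,j} h(dphi e_i, dphi e_j)^2 at p, for an orthonormal
   frame (e_i) at p; the value does not depend on the charts and the frame. *)
Definition symphonic_density (phi : M -> N) (p : M) : R :=
  let c := chart_at SM p in
  let d := chart_at SN (phi p) in
  let E := orthonormal_frame (g c (coord c p)) in
  let dphiE := E *m 'J (local_rep phi c d) (coord c p) in
  let H := h d (coord d (phi p)) in
  \sum_i \sum_j ((dphiE *m H *m dphiE^T) i j) ^+ 2.

Definition symphonic_energy (dv : {measure set (borel M) -> \bar R})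
    (phi : M -> N) : R :=
  \int[dv]_p symphonic_density phi p.

(* Smooth critical points of the symphonic energy (M is compact in all uses,
   so no support condition is imposed on variations). *)
Definition symphonic (dv : {measure set (borel M) -> \bar R})
    (phi : M -> N) : Prop :=
  smooth_map phi /\
  forall (e : R) (Phi : M -> R -> N), smooth_variation phi e Phi ->
    is_derive (0 : R^o) 1
      (fun t : R^o => symphonic_energy dv (Phi^~ t) : R^o) 0.

End Maps.

(* Main.v *)
(* Composing phi with the flow of xi would vary the symphonic energy at the rate
   2 int <phi^* h, phi^* (L_xi h)>, and L_xi h = 2 (lambda h - Ric) is definite, so
   this rate can only vanish if dphi = 0.  Instead of a flow, the field chi xi,
   with chi a cutoff supported where phi takes values in one chart of N, is
   realized by the affine variation  y + t chi xi(y)  of phi in that chart.  Its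
   first variation is

     int chi . 2 <phi^* h, phi^* (L_xi h)> + 2 <phi^* h, X + X^T>,
     X = dchi (x) phi^* (xi^flat),

   where the second term is linear in dchi and does not depend on the charts.
   Summing over cutoffs with sum 1 kills it.  The Lie derivative is always
   computed in the chart of the variation, where the soliton equation gives its
   sign, so that its tensoriality is never needed. *)

From HB Require Import structures.
From mathcomp Require Import all_boot all_order all_algebra.
From mathcomp Require Import all_classical all_reals all_analysis.
From mathcomp Require Import ssrAC perm measurable_realfun ring lra.
(* [Defs] comes last: [coord] is also the name of a vector space function. *)
Require Import Defs.
Set Implicit Arguments.
Unset Strict Implicit.
Unset Printing Implicit Defensive.
Import Order.TTheory GRing.Theory Num.Theory.
Import numFieldNormedType.Exports.
Local Open Scope classical_set_scope.
Local Open Scope ring_scope.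

(** * Functions of class C^k *)

(** Criticality is a statement about the energy along smooth variations, so the proof never forms
    [tau^s] and never integrates by parts. Moving the values of [phi] along straight lines of a
    chart keeps everything explicit: the first variation contains only first derivatives of [phi],
    [xi], [h] and the cutoff. The obstacle is that one chart of N may cover only part of [phi(M)].
    The cutoff therefore lives on M, where compactness provides finitely many bumps, a common time
    during which the moved points stay in the chart, and an expansion of the density in t that is
    uniform in the point. Uniformity and finite volume then give differentiation under the integral.
    The two terms of the first variation are never integrated separately, since neither is shown to
    be continuous: only their sum is integrated, and it reduces to the sign-definite term once the
    cutoffs add up to 1. Of the measure one needs only that M has finite volume and that every
    neighbourhood contains an open set of positive measure. *)

Section Ck.
Variable R : realType.

(** Grading smoothness by an order makes closure under products, inverses and composition provable
    by induction: the derivative of such a function is built from functions of one order less. *)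
Fixpoint Ck (V W : normedModType R) (k : nat) (U : set V) (f : V -> W) : Prop :=
  (forall x, U x -> {for x, continuous f}) /\
  (if k is j.+1 then
     forall v, (forall x, U x -> derivable f x v) /\ Ck j U ('D_v f)
   else True).

Lemma Ck_cont (V W : normedModType R) k (U : set V) (f : V -> W) x :
  Ck k U f -> U x -> {for x, continuous f}.
Proof. by case: k => [|k] [+ _] Ux; apply. Qed.

Lemma Ck_derivable (V W : normedModType R) k (U : set V) (f : V -> W) x v :
  Ck k.+1 U f -> U x -> derivable f x v.
Proof. by case=> _ /(_ v)[+ _]; apply. Qed.
Arguments Ck_derivable {V W k U f x} v _ _.

Lemma Ck_derive (V W : normedModType R) k (U : set V) (f : V -> W) v :
  Ck k.+1 U f -> Ck k U ('D_v f).
Proof. by case=> _ /(_ v)[]. Qed.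

Lemma CkW (V W : normedModType R) k (U : set V) (f : V -> W) :
  Ck k.+1 U f -> Ck k U f.
Proof.
elim: k f => [|k IH] f [fc fd]; first by split.
by split=> // v; have [fv /IH] := fd v.
Qed.

(** The last direction of the list is the first one differentiated, so lists are taken apart from
    the right to match the recursion of [Ck]. *)
Lemma smooth_onP (V W : normedModType R) (U : set V) (f : V -> W) :
  smooth_on U f <-> forall k, Ck k U f.
Proof.
split=> [sf k|].
  elim: k f sf => [|k IH] f sf.
    by split=> // x Ux; have [] := sf [::] 0 x Ux.
  split; first by move=> x Ux; have [] := sf [::] 0 x Ux.
  move=> v; split; first by move=> x Ux; have [] := sf [::] v x Ux.
  apply: IH => ws w x Ux; have := sf (rcons ws v) w x Ux.
  by rewrite foldr_rcons.
move=> cf ws; elim/last_ind: ws f cf => [|ws w IH] f cf v x Ux /=.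
  by split; [exact: (Ck_cont (cf 0%N) Ux)|exact: (Ck_derivable v (cf 1%N) Ux)].
rewrite foldr_rcons; apply: IH => // k; exact: (Ck_derive w (cf k.+1)).
Qed.

Lemma near_eq_continuous (X Y : topologicalType) (f g : X -> Y) x :
  (\near x, f x = g x) -> {for x, continuous f} -> {for x, continuous g}.
Proof.
move=> fg fx; rewrite /prop_for /continuous_at -(nbhs_singleton fg).
by apply: cvg_trans fx; apply: near_eq_cvg.
Qed.

Lemma Ck_congr (V W : normedModType R) k (U : set V) (f g : V -> W) :
  open U -> (forall x, U x -> f x = g x) -> Ck k U f -> Ck k U g.
Proof.
move=> oU; have near_fg (f1 f2 : V -> W) x :
    (forall y, U y -> f1 y = f2 y) -> U x -> \near x, f1 x = f2 x.
  by move=> e Ux; apply: filterS (open_nbhs_nbhs (conj oU Ux)) => y /e.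
elim: k f g => [|k IH] f g fg [fc fd].
  by split=> // x Ux; exact: near_eq_continuous (near_fg _ _ _ fg Ux) (fc x Ux).
split=> [x Ux|v].
  exact: near_eq_continuous (near_fg _ _ _ fg Ux) (fc x Ux).
split=> [x Ux|].
  by apply: (near_eq_derivable (near_fg _ _ _ fg Ux)); exact: (fd v).1.
by apply: IH (fd v).2 => x Ux; apply: near_eq_derive; exact: near_fg.
Qed.

Lemma Ck_sub (V W : normedModType R) k (U U' : set V) (f : V -> W) :
  U' `<=` U -> Ck k U f -> Ck k U' f.
Proof.
move=> s; elim: k f => [|k IH] f [fc fd].
  by split=> // x /s; exact: fc.
split=> [x /s|v]; first exact: fc.
by split=> [x /s|]; [exact: (fd v).1|exact: IH (fd v).2].
Qed.

Lemma Ck_cst (V W : normedModType R) k (U : set V) (a : W) : Ck k U (cst a : V -> W).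
Proof.
elim: k a => [|k IH] a; first by split=> // x _; exact: cst_continuous.
split=> [x _|v]; first exact: cst_continuous.
split=> [x _|]; first exact: derivable_cst.
by rewrite (_ : 'D_v _ = cst 0)//; apply/funext => x; rewrite derive_cst.
Qed.

Lemma CkD (V W : normedModType R) k (U : set V) (f g : V -> W) :
  open U -> Ck k U f -> Ck k U g -> Ck k U (fun x => f x + g x).
Proof.
move=> oU; elim: k f g => [|k IH] f g cf cg.
  by split=> // x Ux; apply: continuousD; [exact: (Ck_cont cf)|exact: (Ck_cont cg)].
split=> [x Ux|v].
  by apply: continuousD; [exact: (Ck_cont cf)|exact: (Ck_cont cg)].
split=> [x Ux|].
  by apply: derivableD; [exact: (Ck_derivable _ cf)|exact: (Ck_derivable _ cg)].
apply: (@Ck_congr _ _ _ _ (fun x => 'D_v f x + 'D_v g x)) => //.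
  by move=> x Ux; rewrite [RHS]deriveD//; [exact: (Ck_derivable _ cf)|exact: (Ck_derivable _ cg)].
by apply: IH; exact: Ck_derive.
Qed.

Lemma CkM (V : normedModType R) k (U : set V) (f g : V -> R^o) :
  open U -> Ck k U f -> Ck k U g -> Ck k U (fun x => (f x : R) * g x : R^o).
Proof.
move=> oU; elim: k f g => [|k IH] f g cf cg.
  by split=> // x Ux; apply: continuousM; [exact: (Ck_cont cf)|exact: (Ck_cont cg)].
split=> [x Ux|v].
  by apply: continuousM; [exact: (Ck_cont cf)|exact: (Ck_cont cg)].
split=> [x Ux|].
  by apply: derivableM; [exact: (Ck_derivable _ cf)|exact: (Ck_derivable _ cg)].
apply: (@Ck_congr _ _ _ _ (fun x => (f x : R) * 'D_v g x + (g x : R) * 'D_v f x)) => //.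
  by move=> x Ux; rewrite [RHS]deriveM//; [exact: (Ck_derivable _ cf)|exact: (Ck_derivable _ cg)].
by apply: CkD => //; apply: IH; (exact: Ck_derive || exact: CkW).
Qed.

Lemma Ck_sum (V W : normedModType R) k (U : set V) (I : Type) (r : seq I)
    (F : I -> V -> W) :
  open U -> (forall i, Ck k U (F i)) -> Ck k U (fun x => \sum_(i <- r) F i x).
Proof.
move=> oU cF; elim: r => [|i r IH].
  rewrite (_ : (fun _ => _) = cst 0); first exact: Ck_cst.
  by apply/funext => x; rewrite big_nil.
rewrite (_ : (fun _ => _) = fun x => F i x + \sum_(j <- r) F j x); first exact: CkD.
by apply/funext => x; rewrite big_cons.
Qed.

Lemma Ck_lin (V W : normedModType R) k (U : set V) (f : {linear V -> W}) :
  continuous f -> Ck k U f.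
Proof.
move=> fc; case: k => [|k]; first by split=> // x _; exact: fc.
split=> [x _|v]; first exact: fc.
split=> [x _|]; first exact/diff_derivable/linear_differentiable.
rewrite (_ : 'D_v _ = cst (f v)); first exact: Ck_cst.
apply/funext => x; rewrite deriveE; last exact: linear_differentiable.
by rewrite diff_lin.
Qed.

Lemma continuous_entry (X : topologicalType) m n (f : X -> 'M[R]_(m, n)) x i j :
  {for x, continuous f} -> {for x, continuous (fun y => f y i j : R^o)}.
Proof.
move=> fc; apply: (@continuous_comp _ _ _ f (fun A : 'M[R]_(m, n) => A i j : R^o) x fc).
exact: matrix_normedtype.coord_continuous.
Qed.

Lemma Ck_mxP (V : normedModType R) m n k (U : set V) (f : V -> 'M[R]_(m, n)) :
  open U -> Ck k U f <-> forall i j, Ck k U (fun x => f x i j : R^o).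
Proof.
move=> oU; elim: k f => [|k IH] f.
  split=> [[cf _] i j|cf].
    split=> // x Ux; apply: continuous_entry; exact: cf.
  split=> // x Ux; apply/cvgrPdist_lt => e e0.
  have : \forall y \near x, forall ij : 'I_m * 'I_n, `|f x ij.1 ij.2 - f y ij.1 ij.2| < e.
    apply: filter_forall => -[i j] /=.
    by have /cvgrPdist_lt /(_ e e0) := (Ck_cont (cf i j) Ux).
  apply: filterS => y fy; rewrite /Num.Def.normr/= mx_normrE.
  by apply: bigmax_lt => // ij _; rewrite !mxE; exact: fy.
split=> [cf i j|cf].
  split=> [x Ux|v].
    by apply: continuous_entry; exact: (Ck_cont cf).
  split=> [x Ux|]; first exact: (derivable_mxP _ _ _).1 (Ck_derivable v cf Ux) i j.
  have /IH := Ck_derive v cf; move=> /(_ i j).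
  apply: Ck_congr => // x Ux.
  rewrite derive_mx ?mxE//; exact: (Ck_derivable _ cf).
split=> [x Ux|v].
  have /IH c : forall i j, Ck k U (fun x => f x i j : R^o) by move=> i j; exact: CkW.
  exact: (Ck_cont c).
have df x : U x -> derivable f x v.
  by move=> Ux; apply/derivable_mxP => i j; exact: (Ck_derivable _ (cf i j)).
split=> //; apply/IH => i j; apply: Ck_congr (Ck_derive v (cf i j)) => // x Ux.
by rewrite derive_mx ?mxE//; exact: df.
Qed.

End Ck.
Arguments Ck_derivable {R V W k U f x} v _ _.

(** * Mean value theorem along lines and strict differentiability *)

Section StrictDifferentiability.
Variable R : realType.

Lemma norm_entry_le m n (A : 'M[R]_(m, n)) i j : `|A i j| <= `|A|.
Proof.
rewrite [leRHS]/Num.Def.normr/= mx_normrE.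
exact: (le_bigmax _ (fun ij => `|A ij.1 ij.2|) (i, j)).
Qed.

Lemma norm_mx_lt m n (A : 'M[R]_(m, n)) (e : R) :
  0 < e -> (forall i j, `|A i j| < e) -> `|A| < e.
Proof.
move=> e0 H; rewrite /Num.Def.normr/= mx_normrE.
by apply: bigmax_lt => // -[i j] _; exact: H.
Qed.

(** Both difference quotients are the same function of the increment; calculus in one real variable
    thereby applies to directional derivatives. *)
Lemma is_derive_line (V W : normedModType R) (f : V -> W) (x v : V) (t : R) :
  derivable f (x + t *: v) v ->
  is_derive t 1 (fun s : R => f (x + s *: v)) ('D_v f (x + t *: v)).
Proof.
have e : (fun h : R => h^-1 *: (((fun s : R => f (x + s *: v)) \o shift t) (h *: 1%R) -
    f (x + t *: v))) =
  (fun h : R => h^-1 *: ((f \o shift (x + t *: v)) (h *: v) - f (x + t *: v))).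
  apply/funext => h /=; congr (_ *: (f _ - _)).
  by rewrite [h *: 1]mulr1 scalerDl addrCA.
by move=> df; split; rewrite /derivable /derive e.
Qed.

(** Homogeneity in the direction holds without Fréchet differentiability: reparametrizing the line
    by [s * a] reduces it to the chain rule in one variable, including the case [a = 0]. *)
Lemma is_derive_dirZ (V : normedModType R) (f : V -> R^o) (x v : V) (a : R) :
  derivable f x v -> is_derive x (a *: v) f (a * 'D_v f x : R^o).
Proof.
move=> df.
have d0 : is_derive (0 : R) 1 (fun s : R => f (x + s *: v)) ('D_v f x).
  have := @is_derive_line _ _ f x v 0; rewrite scale0r addr0; exact.
have da : is_derive (0 : R) 1 (fun s : R => s * a) a.
  have := is_deriveZ a (is_derive_id (0 : R) (1 : R)).
  rewrite [a *: 1]mulr1 (_ : a \*: id = (fun s : R => s * a))//.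
  by apply/funext => s; exact: mulrC.
have dc : is_derive (0 : R) 1 ((fun s : R => f (x + s *: v)) \o (fun s => s * a)) ('D_v f x * a).
  by apply: is_derive1_comp; rewrite mul0r.
have e : (fun h : R => h^-1 *: ((f \o shift x) (h *: (a *: v)) - f x)) =
  (fun h : R => h^-1 *: ((((fun s : R => f (x + s *: v)) \o (fun s => s * a)) \o shift 0)
    (h *: 1%R) -
    ((fun s : R => f (x + s *: v)) \o (fun s => s * a)) 0)).
  apply/funext => h /=; congr (_ *: (f _ - f _)).
    by rewrite addrC [h *: 1]mulr1 addr0 scalerA.
  by rewrite mul0r scale0r addr0.
have [c1 c2] := dc; split.
  by rewrite /derivable e.
by rewrite /derive e mulrC -c2.
Qed.

Lemma MVT_dir (V : normedModType R) (f : V -> R^o) (x v : V) :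
  (forall t : R, 0 <= t <= 1 -> {for x + t *: v, continuous f} /\ derivable f (x + t *: v) v) ->
  exists2 t : R, 0 <= t <= 1 & f (x + v) - f x = 'D_v f (x + t *: v).
Proof.
move=> H.
have [||c] := @MVT_segment R (fun s : R => f (x + s *: v)) (fun t => 'D_v f
  (x + t *: v)) 0 1 ler01.
- move=> t; rewrite in_itv /= => /andP[/ltW t0 /ltW t1].
  by apply: is_derive_line; apply: (H t _).2; rewrite t0.
- apply: derivable_within_continuous => t; rewrite in_itv /= => t01.
  by have [] := is_derive_line (H t t01).2.
rewrite in_itv /= => c01; rewrite scale1r scale0r addr0 subr0 mulr1 => e.
by exists c.
Qed.

(* Passing from y to z one coordinate at a time keeps every intermediate point
   in the sup-norm ball containing y and z. *)
Lemma C1_strict_diff n (U : set 'rV[R]_n) (f : 'rV[R]_n -> R^o) (x : 'rV[R]_n) (e : R) :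
  open U -> Ck 1 U f -> U x -> 0 < e ->
  exists2 r : R, 0 < r & forall y z, ball x r y -> ball x r z ->
    `|f z - f y - \sum_k (z - y) 0 k * 'D_(delta_mx 0 k) f x| <= e * `|z - y|.
Proof.
(* Each of the n coordinate steps may contribute [e']; dividing by [n.+1] avoids a zero denominator
   when [n = 0]. *)
move=> oU cf Ux e0; pose e' := e / n.+1%:R.
have e'0 : 0 < e' by rewrite divr_gt0// ltr0n.
have H : \forall y \near x, U y /\
    forall k : 'I_n, `|'D_(delta_mx 0 k) f x - 'D_(delta_mx 0 k) f y| < e'.
  have HU : \forall y \near x, U y by exact: open_nbhs_nbhs.
  have HD : \forall y \near x, forall k : 'I_n,
      `|'D_(delta_mx 0 k) f x - 'D_(delta_mx 0 k) f y| < e'.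
    apply: (@filter_forall _ _ (fun (k : 'I_n) y =>
      `|'D_(delta_mx 0 k) f x - 'D_(delta_mx 0 k) f y| < e') (nbhs x) _) => k.
    have c := Ck_cont (Ck_derive (delta_mx 0 k) cf) Ux.
    by have /cvgrPdist_lt /(_ _ e'0) := c.
  by near=> y; split; [near: y; exact: HU|near: y; exact: HD].
move: H => /nbhs_ballP[r r0 H]; exists r => // y z By Bz.
have r0' : 0 < r by [].
pose w (k : nat) : 'rV[R]_n := \row_j (if (j < k)%N then z 0 j else y 0 j).
have Bw (k : 'I_n) (t : R) : 0 <= t <= 1 ->
    ball x r (w k + t *: ((z - y) 0 k *: delta_mx 0 k)).
  move=> /andP[t0 t1]; move: By Bz; rewrite -!ball_normE /ball_ /=.
  move=> By Bz; apply: norm_mx_lt => // i j.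
  have := le_lt_trans (norm_entry_le _ i j) By.
  have := le_lt_trans (norm_entry_le _ i j) Bz.
  rewrite !mxE !(ord1 i) /= ?eqxx /=.
  have [->|jk] := eqVneq j k; last first.
    by rewrite mulr0 mulr0 addr0; case: ifP.
  rewrite ltnn mulr1 => Bzk Byk.
  have -> : x 0 k - (y 0 k + t * (z 0 k - y 0 k)) =
    (1 - t) * (x 0 k - y 0 k) + t * (x 0 k - z 0 k) by ring.
  apply: le_lt_trans (ler_normD _ _) _; rewrite !normrM (ger0_norm t0).
  rewrite ger0_norm ?subr_ge0//.
  (* The point is a convex combination of values at distance less than r. Strictness is drawn from
     the summand weighted by t, hence the separate case [t = 0]. *)
  have [->|tn0] := eqVneq t 0; first by rewrite subr0 mul1r mul0r addr0.
  have tp : 0 < t by rewrite lt_neqAle eq_sym tn0.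
  have -> : r = (1 - t) * r + t * r by ring.
  by rewrite ler_ltD ?ltr_pM2l// ler_wpM2l ?subr_ge0// ltW.
have wS (k : 'I_n) : w k.+1 = w k + (z - y) 0 k *: delta_mx 0 k.
  apply/rowP => j; rewrite !mxE eqxx /=.
  have [->|jk] := eqVneq j k; first by rewrite ltnSn ltnn mulr1 addrC subrK.
  by rewrite mulr0 addr0 ltnS leq_eqVlt val_eqE (negbTE jk).
have w0 : w 0%N = y by apply/rowP => j; rewrite mxE.
have wn : w n = z by apply/rowP => j; rewrite mxE ltn_ord.
have step (k : 'I_n) : `|f (w k.+1) - f (w k) - (z - y) 0 k * 'D_(delta_mx 0 k) f x|
    <= e' * `|z - y|.
  have [|t t01] := @MVT_dir _ f (w k) ((z - y) 0 k *: delta_mx 0 k).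
    move=> t /(Bw k) /H[Uw _]; split; first exact: (Ck_cont cf Uw).
    exact: (Ck_derivable _ cf Uw).
  have [Uw Dw] := H _ (Bw k t t01).
  rewrite -wS => ->; have [_ ->] := is_derive_dirZ ((z - y) 0 k) (Ck_derivable
    (delta_mx 0 k) cf Uw).
  rewrite -mulrBr normrM mulrC distrC ler_pM//; first exact/ltW/Dw.
  exact: norm_entry_le.
have -> : f z - f y = \sum_(k < n) (f (w k.+1) - f (w k)).
  by rewrite -(big_mkord xpredT (fun k => f (w k.+1) - f (w k))) telescope_sumr// wn w0.
rewrite -sumrB; apply: le_trans (ler_norm_sum _ _ _) _.
apply: (@le_trans _ _ (\sum_(k < n) e' * `|z - y|)); first by apply: ler_sum.
rewrite sumr_const card_ord -mulr_natl mulrA ler_wpM2r//.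
rewrite /e' mulrCA ler_piMr ?ltW// ltr_pdivrMr ?ltr0n// mul1r ltr_nat//.
Unshelve. all: by end_near. Qed.

End StrictDifferentiability.

(** * Fréchet differentiability and the chain rule *)

Section Chain.
Variable R : realType.

Lemma eps_differentiable (V W : normedModType R) (f : V -> W) (df : {linear V -> W}) x :
  continuous df ->
  (forall e : R, 0 < e -> exists2 r : R, 0 < r &
    forall v, `|v| < r -> `|f (v + x) - f x - df v| <= e * `|v|) ->
  differentiable f x /\ 'd f x = df :> (V -> W).
Proof.
move=> cd H.
have fo : f \o shift x = cst (f x) + df +o_ 0 id.
  apply/eqaddoP => _/posnumP[e].
  have [r r0 K] := H e%:num [gt0 of e%:num].
  apply/nbhs_ballP; exists r => // v; rewrite -ball_normE /ball_ /= sub0r normrN => vr.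
  by rewrite opprD addrA; exact: K.
have dE : 'd f x = df :> (V -> W) by exact: diff_unique cd fo.
by split=> //; apply/diff_locallyP; rewrite dE.
Qed.

(** With the first point frozen at x, the strict estimate is exactly the little-o condition for the
    linear map given by the partial derivatives. *)
Lemma C1_diff n (U : set 'rV[R]_n) (f : 'rV[R]_n -> R^o) (x : 'rV[R]_n) :
  open U -> Ck 1 U f -> U x ->
  differentiable f x /\
  'd f x = (fun v => \sum_k v 0 k * 'D_(delta_mx 0 k) f x) :> ('rV[R]_n -> R^o).
Proof.
move=> oU cf Ux.
pose d (v : 'rV[R]_n) : R^o := \sum_k v 0 k * 'D_(delta_mx 0 k) f x.
have lin_d : linear d.
  move=> a u v; rewrite /d scaler_sumr -big_split; apply: eq_bigr => k _ /=.
  by rewrite !mxE mulrDl -mulrA.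
pose dM := GRing.isLinear.Build _ _ _ _ _ lin_d.
pose dL : {linear _ -> _} := HB.pack d dM.
have cd : continuous dL.
  move=> v; rewrite [dL : _ -> _]/= /d.
  rewrite (_ : (fun _ => _) = (\sum_k (fun u : 'rV[R]_n =>
    u 0 k * 'D_(delta_mx 0 k) f x : R^o))); last first.
    by apply/funext => u; rewrite fct_sumE.
  have : forall k, {for v, continuous (fun u : 'rV[R]_n => u 0 k * 'D_(delta_mx 0 k) f x : R^o)}.
    by move=> k; apply: continuousM; [exact: matrix_normedtype.coord_continuous|exact:
      cst_continuous].
  elim/big_ind: _ => //.
  - by move=> _; exact: cst_continuous.
  - by move=> g h Hg Hh H; apply: continuousD; [exact: Hg|exact: Hh].
  - by move=> k _; apply.
apply: (eps_differentiable cd) => e e0.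
have [r r0 H] := C1_strict_diff oU cf Ux e0.
exists r => // v vr.
have /= := H x (v + x) (ballxx x r0).
by rewrite -ball_normE /ball_ /= distrC addrK; exact.
Qed.

Lemma C1_differentiable n p (U : set 'rV[R]_n) (f : 'rV[R]_n -> 'rV[R]_p) (x : 'rV[R]_n) :
  open U -> Ck 1 U f -> U x -> differentiable f x.
Proof.
move=> oU cf Ux.
have Hd j : differentiable (fun y => f y 0 j *: (delta_mx 0 j : 'rV[R]_p)) x.
  apply: differentiableZl.
  by have [] := C1_diff oU ((Ck_mxP _ _ oU).1 cf 0 j) Ux.
have := @differentiable_sum _ _ _ p (fun j y => f y 0 j *: (delta_mx 0 j : 'rV[R]_p)) x Hd.
congr (differentiable _ _); apply/funext => y.
by rewrite fct_sumE [RHS]matrix_sum_delta big_ord1.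
Qed.

(** Only the outer function has to be Fréchet differentiable: restricting f to a line leaves a
    composition with a function of one real variable. The source can thus be any normed space, in
    particular the product of space and time. *)
Lemma is_derive_comp_diff (V U W : normedModType R) (f : V -> U) (g : U -> W) x v :
  derivable f x v -> differentiable g (f x) ->
  is_derive x v (g \o f) ('d g (f x) ('D_v f x)).
Proof.
move=> df dg; pose F (h : R) := f (h *: v + x).
have dF : derivable F 0 1 := (derivable1P f x v).1 df.
have F0 : F 0 = f x by rewrite /F scale0r add0r.
have dF' : differentiable F 0 by apply/derivable1_diffP.
have dg' : differentiable g (F 0) by rewrite F0.
have dgF : differentiable (g \o F) 0 by exact: differentiable_comp.
have E (Z : normedModType R) (k : V -> Z) : 'D_v k x = 'D_1 (fun h : R => k (h *: v + x)) 0.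
  rewrite /derive; congr (lim (_ @ 0^')); apply/funext => h /=.
  by rewrite addr0 scale0r add0r [_%:A]mulr1.
split; first exact: (derivable1P _ _ _).2 ((derivable1_diffP _ _).2 dgF).
rewrite !E -[fun h => (g \o f) _]/(g \o F) -[fun h => f _]/F.
by rewrite !deriveE// diff_comp//= F0.
Qed.

(** The derivative is the sum of ['D_v f_i] times ['D_i g] composed with f. The induction on k is
    over all g, so that it applies to the partial derivatives of g. *)
Lemma Ck_comp_scalar (V : normedModType R) n k (U : set V) (U' : set 'rV[R]_n)
    (f : V -> 'rV[R]_n) (g : 'rV[R]_n -> R^o) :
  open U -> open U' -> (forall x, U x -> U' (f x)) ->
  Ck k U f -> Ck k U' g -> Ck k U (fun x => g (f x)).
Proof.
move=> oU oU' fU; have cgf k' g' : Ck k' U f -> Ck k' U' g' ->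
    forall x, U x -> {for x, continuous (fun y => g' (f y) : R^o)}.
  move=> cf cg x Ux; apply: (@continuous_comp _ _ _ f g'); first exact: (Ck_cont cf).
  exact: (Ck_cont cg (fU x Ux)).
elim: k g => [|k IH] g cf cg; first by split=> //; exact: cgf cg.
have C1 j (W : normedModType R) (h : 'rV[R]_n -> W) : Ck j.+1 U' h -> Ck 1 U' h.
  by elim: j => // j IHj /CkW.
have D x v : U x -> is_derive x v (g \o f)
    (\sum_i 'D_v f x 0 i * 'D_(delta_mx 0 i) g (f x) : R^o).
  move=> Ux; have [d1 d2] := C1_diff oU' (C1 _ _ _ cg) (fU x Ux).
  by have := is_derive_comp_diff (Ck_derivable v cf Ux) d1; rewrite d2.
split=> [|v]; first exact: cgf cg.
split=> [x Ux|]; first by have [] := D x v Ux.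
apply: (@Ck_congr _ _ _ _ _ (fun x => \sum_i 'D_v f x 0 i * 'D_(delta_mx 0 i) g (f x) : R^o)) =>
  //.
  by move=> x Ux; have [_ <-] := D x v Ux.
apply: Ck_sum => // i; apply: CkM => //.
  exact: (Ck_mxP _ _ oU).1 (Ck_derive v cf) 0 i.
by apply: (IH ('D_(delta_mx 0 i) g)); [exact: CkW|exact: Ck_derive].
Qed.

Lemma Ck_comp (V : normedModType R) n p q k (U : set V) (U' : set 'rV[R]_n)
    (f : V -> 'rV[R]_n) (g : 'rV[R]_n -> 'M[R]_(p, q)) :
  open U -> open U' -> (forall x, U x -> U' (f x)) ->
  Ck k U f -> Ck k U' g -> Ck k U (fun x => g (f x)).
Proof.
move=> oU oU' fU cf cg; apply/Ck_mxP => // i j.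
exact: (Ck_comp_scalar oU oU' fU cf ((Ck_mxP _ _ oU').1 cg i j)).
Qed.

End Chain.

(** * Smooth bump functions *)

Section Bump.
Variable R : realType.

(** The triangle inequality reduces to monomials, where the exponential series gives
    [x^(i+1) <= (i+1)! e^x]. *)
Lemma horner_expRN_bounded (Q : {poly R}) :
  exists C : R, forall x : R, 0 < x -> `|Q.[x] * expR (- x)| <= C.
Proof.
elim/poly_ind: Q => [|Q c _]; first by exists 0 => x _; rewrite horner0 mul0r normr0.
suff [C HC] : exists C : R, forall x : R, 0 < x ->
    \sum_(i < size (Q * 'X + c%:P)) `|(Q * 'X + c%:P)`_i| * x ^+ i * expR (- x) <= C.
  exists C => x x0; apply: le_trans (HC x x0).
  rewrite horner_coef normrM [`|expR _|]ger0_norm ?expR_ge0// -mulr_suml.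
  rewrite ler_wpM2r ?expR_ge0//.
  apply: le_trans (ler_norm_sum _ _ _) _; apply: ler_sum => i _.
  by rewrite normrM [`|x ^+ _|]ger0_norm// exprn_ge0// ltW.
have M (i : nat) : exists C : R, forall x : R, 0 < x -> x ^+ i * expR (- x) <= C.
  case: i => [|i].
    by exists 1 => x x0; rewrite mul1r -expR0 ler_expR oppr_le0 ltW.
  exists i.+1`!%:R => x x0.
  rewrite expRN ler_pdivrMr ?expR_gt0// -ler_pdivrMl ?ltr0n ?fact_gt0// mulrC.
  by apply: le_trans (expR_ge1Dxn i (ltW x0)); rewrite lerDr.
have {}M i := cid (M i).
exists (\sum_(i < size (Q * 'X + c%:P)) `|(Q * 'X + c%:P)`_i| * sval (M i)) => x x0.
apply: ler_sum => i _; rewrite -mulrA ler_wpM2l//.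
exact: (svalP (M i)).
Qed.

(* The factor [P(1/s)] makes the family closed under differentiation. *)
Definition eta (P : {poly R}) (s : R) : R :=
  if 0 < s then P.[s^-1] * expR (- s^-1) else 0.

(** For [s > 0], differentiating [P(1/s) e^(-1/s)] produces the factor [s^-2 (P - P')(1/s)]. At 0
    the right difference quotient is h times the bounded quantity [h^-2 P(1/h) e^(-1/h)], so it
    tends to 0. *)
Lemma is_derive_eta (P : {poly R}) (s : R) :
  is_derive s 1 (eta P) (eta ('X^2 * (P - P^`())) s).
Proof.
have [s0|s0|s0] := ltgtP 0 s.
- have nE : \near s, P.[s^-1] * expR (- s^-1) = eta P s.
    by near=> t; rewrite /eta ifT//; near: t; exact: lt_nbhsr.
  apply: (near_eq_is_derive nE).
  have sn0 : s != 0 by rewrite gt_eqF.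
  have dV : is_derive s (1 : R) (fun t : R => t^-1) (- s ^- 2).
    have := is_deriveV sn0 (is_derive_id s (1 : R)).
    by rewrite /= [_ *: 1]mulr1.
  have dP : is_derive s (1 : R) (horner P \o (fun t : R => t^-1)) (P^`().[s^-1] * - s ^- 2).
    have dH : is_derive s^-1 (1 : R) (horner P) P^`().[s^-1].
      by split; [exact: derivable_horner|rewrite -derive1E derivE].
    exact: is_derive1_comp.
  have dE : is_derive s (1 : R) (expR \o (fun t : R => - t^-1)) (expR (- s^-1) * s ^- 2).
    have dN : is_derive s (1 : R) (fun t : R => - t^-1) (s ^- 2).
      by have := is_deriveN dV; rewrite opprK.
    exact: is_derive1_comp.
  have dM := is_deriveM dP dE.
  rewrite -[fun t => _]/((horner P \o (fun t : R => t^-1)) * (expR \o (fun t : R => - t^-1))).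
  apply: (is_derive_eq dM); rewrite /eta s0 !hornerE /= -exprVn.
  rewrite -!mulrA; rewrite /GRing.scale /=; ring.
- have nE : \near s, (cst 0 : R -> R) s = eta P s.
    near=> t; rewrite /eta ifF//; apply/negbTE; rewrite -leNgt ltW//.
    by near: t; exact: lt_nbhsl.
  apply: (near_eq_is_derive nE).
  rewrite /eta ifF; last by apply/negbTE; rewrite -leNgt ltW.
  exact: is_derive_cst.
- rewrite -s0 /eta ltxx.
  suff H : (fun h : R => h^-1 *: ((eta P \o shift 0) (h *: 1%R) - eta P 0)) @ 0^' --> (0 : R).
    split; first by apply/cvg_ex; exists 0.
    exact/cvg_lim.
  have [C HC] := horner_expRN_bounded ('X^2 * P).
  have C0 : 0 <= C by exact: le_trans (HC 1 ltr01).
  apply/cvgrPdist_le => e e0; near=> h.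
  rewrite sub0r normrN /= addr0 {2}/eta ltxx subr0 [h *: 1]mulr1 /eta.
  case: ifPn => h0; last by rewrite scaler0 normr0 ltW.
  have := HC h^-1; rewrite invr_gt0 => /(_ h0).
  rewrite !hornerE => HCh.
  have -> : h^-1 *: (P.[h^-1] * expR (- h^-1)) =
     h * (h^-1 ^+ 2 * P.[h^-1] * expR (- h^-1)).
    rewrite /GRing.scale /= expr2 !mulrA divff ?mul1r// gt_eqF//.
  rewrite normrM (gtr0_norm h0).
  apply: le_trans (ler_wpM2l (ltW h0) HCh) _.
  (* The bound C may be 0; [C + 1] is a positive divisor for the threshold on h. *)
  apply: (@le_trans _ _ (h * (C + 1))); first by rewrite ler_wpM2l ?lerDl// ltW.
  rewrite -ler_pdivlMr ?ltr_wpDl//.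
  apply: le_trans (ler_norm _) _; apply: ltW.
  by near: h; apply: dnbhs0_lt; rewrite divr_gt0// ltr_wpDl.
Unshelve. all: by end_near. Qed.

Lemma Ck_eta (V : normedModType R) k (U : set V) (f : V -> R^o) (P : {poly R}) :
  open U -> Ck k U f -> Ck k U (fun x => eta P (f x) : R^o).
Proof.
move=> oU.
have cc j P' f' : Ck j U f' -> forall x, U x -> {for x, continuous (fun x => eta P'
  (f' x) : R^o)}.
  move=> cf x Ux; apply: (@continuous_comp _ _ _ f' (eta P' : R^o -> R^o)).
    exact: (Ck_cont cf).
  apply: differentiable_continuous; apply/derivable1_diffP.
  by have [] := is_derive_eta P' (f' x).
elim: k P f => [|k IH] P f cf; first by split=> //; exact: cc cf.
have D x v : U x -> is_derive x v ((eta P : R^o -> R^o) \o f)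
    ((eta ('X^2 * (P - P^`())) (f x) : R) * 'D_v f x : R^o).
  move=> Ux; have [d1 d2] := is_derive_eta P (f x).
  have d3 : differentiable (eta P : R^o -> R^o) (f x) by apply/derivable1_diffP.
  apply: (is_derive_eq (is_derive_comp_diff (Ck_derivable v cf Ux) d3)).
  apply: (etrans (congr1 (@^~ ('D_v f x)) (diff1E d3))).
  by rewrite derive1E d2; exact: mulrC.
split=> [|v]; first exact: cc cf.
split=> [x Ux|]; first by have [] := D x v Ux.
apply: (@Ck_congr _ _ _ _ _ (fun x => (eta ('X^2 * (P - P^`())) (f x) : R) * 'D_v f x : R^o)) =>
  //.
  by move=> x Ux; have [_ <-] := D x v Ux.
by apply: CkM => //; [apply: IH; exact: CkW|exact: Ck_derive].
Qed.

Lemma eta1E (s : R) : 0 < s -> eta 1 s = expR (- s^-1).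
Proof. by move=> s0; rewrite /eta s0 hornerE mul1r. Qed.

Lemma bump_exists n (p : 'rV[R]_n) (r : R) : 0 < r ->
  exists b : 'rV[R]_n -> R^o, [/\ forall k, Ck k setT b,
    forall u, 0 <= b u <= 1, \forall u \near p, b u = 1 &
    forall u, b u != 0 -> ball p r u].
Proof.
(* The squared Euclidean distance is polynomial, unlike the sup norm that defines the balls. It
   makes [s p = -1], and outside [ball p r] a single coordinate already contributes [r^2], which
   forces [s u >= 1]. *)
move=> r0; pose s (u : 'rV[R]_n) : R^o := (r / 2) ^- 2 * \sum_k (u 0 k - p 0 k) ^+ 2 - 1.
(* [e eta(1 - e eta(s))] equals 1 for [s <= 0] and 0 for [s >= 1]. *)
exists (fun u => expR 1 * eta 1 (1 - expR 1 * eta 1 (s u))).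
have r20 : 0 < (r / 2) ^+ 2 by rewrite exprn_gt0// divr_gt0.
have Cs k : Ck k setT s.
  apply: CkD; [exact: openT| |exact: Ck_cst].
  apply: CkM; [exact: openT|exact: Ck_cst|].
  apply: Ck_sum => [|i]; first exact: openT.
  have Ci : Ck k setT (fun u : 'rV[R]_n => u 0 i - p 0 i : R^o).
    apply: CkD; [exact: openT| |exact: Ck_cst].
    have Cid : Ck k setT (idfun : {linear 'rV[R]_n -> 'rV[R]_n}).
      by apply: Ck_lin => u; exact: cvg_id.
    exact: (Ck_mxP _ _ openT).1 Cid 0 i.
  by apply: CkM; [exact: openT|exact: Ci|exact: Ci].
have eta_ge0 (t : R) : 0 <= eta 1 t.
  by rewrite /eta; case: ifP => // _; rewrite hornerE mul1r expR_ge0.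
split.
- move=> k; apply: CkM; [exact: openT|exact: Ck_cst|].
  apply: Ck_eta; first exact: openT.
  apply: CkD; [exact: openT|exact: Ck_cst|].
  rewrite (_ : (fun _ => _) = (fun u => (- expR 1 : R) * eta 1 (s u) : R^o)); last first.
    by apply/funext => u; rewrite mulNr.
  apply: CkM; [exact: openT|exact: Ck_cst|].
  by apply: Ck_eta; first exact: openT.
- move=> u; rewrite mulr_ge0 ?expR_ge0//=.
  set t := (X in eta 1 X).
  have t1 : t <= 1 by rewrite lerBlDr lerDl mulr_ge0// expR_ge0.
  have [t0|t0] := ltP 0 t; last by rewrite /eta ltNge t0 mulr0.
  by rewrite eta1E// -expRD expR_le1 subr_le0 invf_ge1.
- have : {for p, continuous s} by exact: (Ck_cont (Cs 0%N)).
  have sp : s p < 0.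
    rewrite /s big1 ?mulr0 ?sub0r ?ltrN10// => k _.
    by rewrite subrr expr0n.
  move=> sc; have sn : \forall u \near p, s u < 0 by exact: (sc _ (lt_nbhsl sp)).
  apply: filterS sn => u su.
  rewrite {2}/eta [0 < s u]ltNge (ltW su) /= mulr0 subr0 eta1E// invr1.
  by rewrite -expRD subrr expR0.
- move=> u bu; rewrite -ball_normE /ball_ /= ltNge; apply/negP => pu.
  move: bu; apply/negP; rewrite negbK; apply/eqP.
  have [k ruk] : exists k, r <= `|p 0 k - u 0 k|.
    apply: contrapT => /forallNP H; move: pu; apply/negP; rewrite -ltNge.
    apply: norm_mx_lt => // i j; rewrite !mxE (ord1 i) ltNge.
    by apply/negP; exact: H.
  have s3 : 1 <= s u.
    rewrite /s lerBrDr -ler_pdivrMl ?invr_gt0// invrK.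
    apply: (@le_trans _ _ (r ^+ 2)); first by nra.
    rewrite (bigD1 k)//= -[leLHS]addr0 lerD ?sumr_ge0//.
      rewrite -[leRHS]real_normK ?num_real// distrC ler_pXn2r ?nnegrE//; exact: ltW.
    by move=> j _; exact: sqr_ge0.
  rewrite /eta ifF ?mulr0//; apply/negbTE; rewrite -leNgt subr_le0.
  have s0 : 0 < s u by exact: lt_le_trans s3.
  by rewrite -/(eta 1 (s u)) eta1E// -expRD -[leLHS]expR0 ler_expR subr_ge0 invf_le1.
Qed.

End Bump.

(** * Positive definite matrices *)

Section PositiveDefinite.
Variable R : realType.

Definition posdef n (G : 'M[R]_n) : Prop :=
  forall v : 'rV[R]_n, v != 0 -> 0 < (v *m G *m v^T) 0 0.

Lemma posdef_congr n (G L : 'M[R]_n) :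
  L \in unitmx -> posdef G -> posdef (L *m G *m L^T).
Proof.
move=> uL pG v v0; have := pG (v *m L).
rewrite trmx_mul !mulmxA; apply; apply: contra v0 => /eqP vL.
by rewrite -[v](mulmxK uL) vL mul0mx.
Qed.

(** Symmetric Gaussian elimination: L clears the first row and column, the Schur complement D'
    inherits positive definiteness, and an orthonormal basis for D' is completed by the first vector
    scaled by [a^(-1/2)]. *)
Lemma posdef_orthonormal n (G : 'M[R]_n) :
  G^T = G -> posdef G -> exists E : 'M[R]_n, E *m G *m E^T = 1%:M.
Proof.
elim: n G => [|n IH] G; first by exists 1%:M; rewrite flatmx0 [RHS]flatmx0.
move: G; rewrite -[n.+1]/(1 + n)%N => G' sG pG.
have [a [b [D GE]]] : exists a b D, G' = block_mx a b b^T D.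
  exists (ulsubmx G'), (ursubmx G'), (drsubmx G').
  by rewrite trmx_ursub sG submxK.
have sD : D^T = D.
  have : (drsubmx G')^T = drsubmx G' by rewrite trmx_drsub sG.
  by rewrite GE block_mxKdr.
have a0 : 0 < a 0 0.
  have := pG (row_mx (1%:M : 'M[R]_1) 0).
  rewrite GE mul_row_block !mul1mx !mul0mx !addr0 tr_row_mx mul_row_col.
  rewrite trmx1 trmx0 mulmx0 mulmx1 addr0; apply.
  apply/eqP => /rowP /(_ (lshift n 0)); rewrite row_mxEl !mxE /= => /eqP.
  by rewrite oner_eq0.
pose c := (a 0 0)^-1.
have aE : a = (a 0 0)%:M by rewrite [LHS]mx11_scalar.
pose L : 'M[R]_(1 + n) := block_mx 1%:M 0 (- c *: b^T) 1%:M.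
have uL : L \in unitmx by rewrite unitmxE det_lblock !det1 mul1r unitr1.
have E1 : (- c *: b^T) *m a + b^T = 0.
  rewrite aE mul_mx_scalar scalerA mulrN /c divff ?gt_eqF// scaleN1r addNr //.
have E2 : a *m (- c *: b) + b = 0.
  rewrite aE mul_scalar_mx scalerA mulrN /c divff ?gt_eqF// scaleN1r addNr //.
pose D' := (- c *: b^T) *m b + D.
have LGL : L *m G' *m L^T = block_mx a 0 0 D'.
  rewrite GE /L tr_block_mx !mulmx_block !trmx1 trmx0 !mul1mx !mul0mx !mulmx1.
  rewrite !mulmx0 !addr0 linearZ /= trmxK E1 E2 !mul0mx add0r.
  by [].
have sD' : D'^T = D'.
  by rewrite /D' linearD /= trmx_mul linearZ /= trmxK sD -scalemxAl -scalemxAr.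
have pD' : posdef D'.
  move=> v v0; have := posdef_congr uL pG; rewrite LGL.
  move=> /(_ (row_mx 0 v)).
  rewrite mul_row_block !mul0mx !mulmx0 !add0r tr_row_mx mul_row_col mul0mx add0r.
  apply; apply: contra v0 => /eqP e.
  have := congr1 (@rsubmx _ 1 1 n) e; rewrite row_mxKr => ->.
  by apply/eqP/rowP => j; rewrite !mxE.
have [E' EE] := IH D' sD' pD'.
pose s := Num.sqrt (a 0 0).
have s0 : 0 < s by rewrite sqrtr_gt0.
pose B : 'M[R]_(1 + n) := block_mx (s^-1)%:M 0 0 E'.
exists (B *m L).
have -> : B *m L *m G' *m (B *m L)^T = B *m (L *m G' *m L^T) *m B^T.
  by rewrite trmx_mul !mulmxA.
rewrite LGL /B tr_block_mx !mulmx_block !trmx0 !mulmx0 !mul0mx !addr0 !add0r.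
rewrite EE tr_scalar_mx aE -!scalar_mxM.
have -> : s^-1 * a 0 0 * s^-1 = 1.
  by rewrite -[a 0 0]sqr_sqrtr ?ltW// -/s expr2 mulrA mulVf ?gt_eqF// mul1r divff ?gt_eqF.
by rewrite !mul0mx -scalar_mx_block.
Qed.

(** The completeness relation of an orthonormal frame. It trades sums over a frame for traces
    against the inverse metric. *)
Lemma invmx_orthonormal n (G E : 'M[R]_n) :
  E *m G *m E^T = 1%:M -> G \in unitmx /\ invmx G = E^T *m E.
Proof.
rewrite -mulmxA => /mulmx1C; rewrite -mulmxA => e.
have [uG _] := mulmx1_unit e; split=> //.
by rewrite -[RHS](mulKmx uG) e mulmx1.
Qed.

Lemma posdef_unit n (G : 'M[R]_n) : G^T = G -> posdef G -> G \in unitmx.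
Proof. by move=> sG /(posdef_orthonormal sG)[E /invmx_orthonormal[]]. Qed.

Lemma sum_sqr_mxtrace m n (A : 'M[R]_(m, n)) :
  \sum_i \sum_j A i j ^+ 2 = \tr (A *m A^T).
Proof. by apply: eq_bigr => i _; rewrite mxE; apply: eq_bigr => j _; rewrite mxE expr2. Qed.

Lemma mxtrace_gram_eq0 m n (A : 'M[R]_(m, n)) : \tr (A *m A^T) = 0 -> A = 0.
Proof.
rewrite -sum_sqr_mxtrace => H; apply/matrixP => i j; rewrite mxE.
have Hi := psumr_eq0P (fun i _ => sumr_ge0 _ (fun j _ => sqr_ge0 (A i j))) H.
have := psumr_eq0P (fun j _ => sqr_ge0 (A i j)) (Hi i isT).
by move=> /(_ j isT)/eqP; rewrite sqrf_eq0 => /eqP.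
Qed.

Lemma mxtrace_posdef m n (L : 'M[R]_n) (A : 'M[R]_(m, n)) : posdef L ->
  0 <= \tr (A *m L *m A^T) /\ (\tr (A *m L *m A^T) = 0 -> A = 0).
Proof.
move=> pL.
have E i : (A *m L *m A^T) i i = (row i A *m L *m (row i A)^T) 0 0.
  rewrite !mxE; apply: eq_bigr => k _; rewrite !mxE; congr (_ * _).
  by apply: eq_bigr => l _; rewrite !mxE.
have P i : 0 <= (A *m L *m A^T) i i.
  rewrite E; have [->|/pL/ltW//] := eqVneq (row i A) 0.
  by rewrite mul0mx mul0mx mxE.
split; first by apply: sumr_ge0.
move=> /(psumr_eq0P (fun i _ => P i)) H; apply/row_matrixP => i.
rewrite row0; apply/eqP; apply: contraT => /pL.
by rewrite -E H// ltxx.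
Qed.

(** The pointwise rigidity: pairing [phi^* h] with the pullback of a positive definite form detects
    [dphi]. Writing [G^-1 = E^T E], [h = C C^T] and [P = (E J)^T (E J)], the trace is that of
    [B L B^T] with [B = C^T P]. If it is 0, then B vanishes, hence P, hence [E J], hence J. *)
Lemma mxtrace_pullback_posdef m n (G : 'M[R]_m) (h L : 'M[R]_n) (J : 'M[R]_(m, n)) :
  G^T = G -> posdef G -> h^T = h -> posdef h -> posdef L ->
  let t := \tr (invmx G *m (J *m L *m J^T) *m invmx G *m (J *m h *m J^T)) in
  0 <= t /\ (t = 0 -> J = 0).
Proof.
move=> sG pG sh ph pL t.
have [E EE] := posdef_orthonormal sG pG.
have [uG GE] := invmx_orthonormal EE.
have [F FE] := posdef_orthonormal sh ph.
have [uh hE] := invmx_orthonormal FE.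
have uF : F \in unitmx by have := mulmx1_unit FE => -[_]; rewrite unitmx_tr.
have uE : E \in unitmx by have := mulmx1_unit EE => -[_]; rewrite unitmx_tr.
pose C := invmx F.
have hC : h = C *m C^T.
  have CF : C *m F = 1%:M by rewrite mulVmx.
  have FC : F^T *m C^T = 1%:M by rewrite -trmx_mul CF trmx1.
  transitivity (C *m (F *m h *m F^T) *m C^T); last by rewrite FE mulmx1.
  by rewrite !mulmxA CF mul1mx -mulmxA FC mulmx1.
pose A := E *m J; pose P := A^T *m A.
have tE : t = \tr (C^T *m P *m L *m (C^T *m P)^T).
  rewrite /t GE hC.
  have -> : (C^T *m P)^T = P *m C by rewrite trmx_mul trmxK /P trmx_mul trmxK.
  rewrite /P /A trmx_mul.
  transitivity (\tr (C^T *m J^T *m (E^T *m E *m J *m L *m J^T *m E^T *m E *m J *m C))).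
    by rewrite [RHS]mxtrace_mulC !mulmxA.
  by rewrite !mulmxA.
have [t1 t2] := mxtrace_posdef (C^T *m P) pL; rewrite tE; split=> // /t2 CP.
have P0 : P = 0.
  have uC : C^T \in unitmx by rewrite unitmx_tr unitmx_inv.
  by rewrite -[P](mulKmx uC) CP mulmx0.
have A0 : A^T = 0 by apply: mxtrace_gram_eq0; rewrite trmxK -/P P0 mxtrace0.
by rewrite -[J](mulKmx uE) -/A -[A]trmxK A0 trmx0 mulmx0.
Qed.

End PositiveDefinite.

(** * Charts *)

Section Jacobian.
Variable R : realType.

Lemma near_eq_differentiable (V W : normedModType R) (f g : V -> W) x :
  (\near x, f x = g x) -> differentiable f x ->
  differentiable g x /\ 'd g x = 'd f x :> (V -> W).
Proof.
move=> fg df; apply: eps_differentiable; first exact: diff_continuous.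
move=> e e0; have := diff_locally df => /eqaddoP /(_ e e0) H.
have fgx : \forall v \near (0 : V), f (v + x) = g (v + x).
  have /nbhs_ballP[s s0 Hs] := fg; apply/nbhs_ballP; exists s => // v.
  rewrite -ball_normE /ball_ /= sub0r normrN => vs; apply: Hs.
  by rewrite -ball_normE /ball_ /= opprD addrCA subrr addr0 normrN.
have HH : nbhs (0 : V) (fun v => `|(f \o shift x - (cst (f x) + 'd f x)) v| <= e * `|v| /\
    f (v + x) = g (v + x)) by exact: filterI H fgx.
have /nbhs_ballP[r r0 K] := HH; exists r => // v vr.
have /K[/= K1 K2] : ball (0 : V) r v by rewrite -ball_normE /ball_ /= sub0r normrN.
by rewrite -(nbhs_singleton fg) -K2 -addrA -opprD.
Qed.

Lemma eq_mulmx_rV a b (A B : 'M[R]_(a, b)) :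
  (forall v : 'rV[R]_a, v *m A = v *m B) -> A = B.
Proof. by move=> AB; apply/row_matrixP => i; rewrite !rowE. Qed.

Lemma mul_jacobian a b (f : 'rV[R]_a -> 'rV[R]_b) x v : v *m 'J f x = 'd f x v.
Proof. by rewrite /jacobian mul_rV_lin1. Qed.

Lemma near_eq_jacobian a b (f g : 'rV[R]_a -> 'rV[R]_b) x :
  (\near x, f x = g x) -> differentiable f x -> 'J g x = 'J f x.
Proof.
move=> fg /(near_eq_differentiable fg)[_ e].
apply: eq_mulmx_rV => v; rewrite [LHS]mul_jacobian [RHS]mul_jacobian.
exact: (congr1 (@^~ v) e).
Qed.

Lemma jacobian_id a (x : 'rV[R]_a) :
  differentiable (idfun : 'rV[R]_a -> 'rV[R]_a) x /\
  'J (idfun : 'rV[R]_a -> 'rV[R]_a) x = 1%:M.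
Proof.
have cid : continuous (idfun : {linear 'rV[R]_a -> 'rV[R]_a}) by move=> u; exact: cvg_id.
split; first exact: (linear_differentiable x cid).
apply: eq_mulmx_rV => v; rewrite mul_jacobian mulmx1.
exact: (congr1 (@^~ v) (diff_lin x cid)).
Qed.

Lemma jacobian_comp a b c (f : 'rV[R]_a -> 'rV[R]_b) (g : 'rV[R]_b -> 'rV[R]_c) x :
  differentiable f x -> differentiable g (f x) ->
  'J (g \o f) x = 'J f x *m 'J g (f x).
Proof.
move=> df dg; apply: eq_mulmx_rV => v.
by rewrite mulmxA !mul_jacobian diff_comp.
Qed.

Lemma jacobianE a b (f : 'rV[R]_a -> 'rV[R]_b) x i j :
  differentiable f x -> 'J f x i j = 'D_(delta_mx 0 i) (fun y => f y 0 j : R^o) x.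
Proof.
move=> df; have d : derivable f x (delta_mx 0 i) by exact: diff_derivable.
have := congr1 (fun A : 'rV[R]_b => A 0 j) (derive_mx d).
rewrite deriveEjacobian// -rowE !mxE; exact.
Qed.

End Jacobian.

Section Traces.
Variable R : realType.

(** Change of coordinates on the source: the factors T cancel against those of the inverse metric,
    so the pairing of two bilinear forms does not depend on the chart of M. *)
Lemma mxtrace_invmx_congr m (G T A B : 'M[R]_m) :
  G \in unitmx -> T \in unitmx ->
  \tr (invmx (T *m G *m T^T) *m (T *m A *m T^T) *m
       invmx (T *m G *m T^T) *m (T *m B *m T^T)) =
  \tr (invmx G *m A *m invmx G *m B).
Proof.
move=> uG uT.
have uTt : T^T \in unitmx by rewrite unitmx_tr.
have e : invmx (T *m G *m T^T) = invmx T^T *m invmx G *m invmx T.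
  have uTG : T *m G *m T^T \in unitmx by rewrite !unitmx_mul uT uG uTt.
  rewrite -[RHS](mulmxK uTG) -!mulmxA (mulmxA (invmx T) T) (mulVmx uT) mul1mx.
  by rewrite (mulmxA (invmx G) G) (mulVmx uG) mul1mx !mulmxA (mulVmx uTt) mul1mx.
rewrite e -!mulmxA !(mulmxA (invmx T) T) (mulVmx uT) !mul1mx.
rewrite (mulmxA T^T (invmx T^T)) (mulmxV uTt) mul1mx mxtrace_mulC -!mulmxA.
by rewrite (mulmxV uTt) mulmx1.
Qed.

End Traces.

Section Charts.
Variables (R : realType) (m : nat) (M : topologicalType).
Implicit Types c d : chart R m M.

Lemma imgP c u : img c u -> dom c (param c u) /\ coord c (param c u) = u.
Proof. by move=> [p cp <-]; rewrite coordK. Qed.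

Lemma img_coord c p : dom c p -> img c (coord c p).
Proof. by move=> cp; exists p. Qed.

Lemma open_chart_preimage c (O : set M) : open O ->
  open [set u | img c u /\ O (param c u)].
Proof.
move=> oO; rewrite openE => u [cu Ou].
have H1 : \forall v \near u, img c v by apply: open_nbhs_nbhs; split=> //; exact: open_img.
have H2 : \forall v \near u, O (param c v).
  have := param_continuous cu; apply; exact: open_nbhs_nbhs.
by rewrite /interior; near=> v; split; [exact: (near H1 v)|exact: (near H2 v)].
Unshelve. all: by end_near. Qed.

Lemma overlapE c d : overlap c d = [set u | img c u /\ dom d (param c u)].
Proof.
apply/seteqP; split=> [_ [p [cp dp] <-]|u [[p cp <-]]] /=.
  by rewrite coordK//; split=> //; exact: img_coord.
by rewrite coordK// => dp; exists p.
Qed.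

Lemma open_overlap c d : open (overlap c d).
Proof. by rewrite overlapE; apply: open_chart_preimage; exact: open_dom. Qed.

Lemma near_param c p (O : set M) : dom c p -> nbhs p O ->
  \forall u \near coord c p, O (param c u).
Proof.
move=> cp Op; have := param_continuous (img_coord cp); apply.
by rewrite coordK.
Qed.

Lemma near_img c p : dom c p -> \forall u \near coord c p, img c u.
Proof. by move=> cp; apply: open_nbhs_nbhs; split; [exact: open_img|exact: img_coord]. Qed.

Lemma near_dom c p : dom c p -> nbhs p (dom c).
Proof. by move=> cp; apply: open_nbhs_nbhs; split=> //; exact: open_dom. Qed.

Lemma transition_coord c d p : dom c p -> transition c d (coord c p) = coord d p.
Proof. by move=> cp; rewrite /transition /= coordK. Qed.

Lemma overlap_coord c d p : dom c p -> dom d p -> overlap c d (coord c p).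
Proof. by exists p. Qed.

Variable S : smooth_manifold R m M.

Lemma transition_smooth c d : atlas S c -> atlas S d ->
  smooth_on (overlap c d) (transition c d).
Proof. by move=> Sc Sd; have [] := atlas_compatible Sc Sd. Qed.

Lemma transition_differentiable c d p : atlas S c -> atlas S d ->
  dom c p -> dom d p -> differentiable (transition c d) (coord c p).
Proof.
move=> Sc Sd cp dp.
have C1 : Ck 1 (overlap c d) (transition c d).
  exact: (smooth_onP _ _).1 (transition_smooth Sc Sd) 1%N.
exact: (C1_differentiable (@open_overlap c d) C1 (overlap_coord cp dp)).
Qed.

Lemma jacobian_transition_unit c d p : atlas S c -> atlas S d ->
  dom c p -> dom d p -> 'J (transition c d) (coord c p) \in unitmx.
Proof.
move=> Sc Sd cp dp.
have e : 'J (transition c d) (coord c p) *m 'J (transition d c) (coord d p) = 1%:M.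
  have d1 := transition_differentiable Sc Sd cp dp.
  have d2 : differentiable (transition d c) (transition c d (coord c p)).
    by rewrite transition_coord//; exact: transition_differentiable.
  rewrite -(transition_coord d cp) -jacobian_comp//.
  have H : \forall u \near coord c p, idfun u = (transition d c \o transition c d) u.
    have Hi := near_img cp; have Hd := near_param cp (near_dom dp).
    near=> u; rewrite /transition /= coordK; last exact: (near Hd u).
    have Hu : img c u by exact: (near Hi u).
    by have [_ ->] := imgP Hu.
  have [did Jid] := jacobian_id (coord c p).
  by rewrite (near_eq_jacobian H).
exact: (mulmx1_unit e).1.
Unshelve. all: by end_near. Qed.

Lemma chart_atP p : atlas S (chart_at S p) /\ dom (chart_at S p) p.
Proof. by rewrite /chart_at; case: cid2. Qed.

Variable g : riemannian_metric S.

Lemma metric_posdef c p : atlas S c -> dom c p -> posdef (g c (coord c p)).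
Proof. by move=> Sc cp v v0; apply: metric_pos => //; exact: img_coord. Qed.

Lemma metric_symm c p : atlas S c -> dom c p -> (g c (coord c p))^T = g c (coord c p).
Proof. by move=> Sc cp; apply: metric_sym => //; exact: img_coord. Qed.

Lemma metric_unit c p : atlas S c -> dom c p -> g c (coord c p) \in unitmx.
Proof. by move=> Sc cp; apply: posdef_unit; [exact: metric_symm|exact: metric_posdef]. Qed.

Lemma metric_transition c d p : atlas S c -> atlas S d -> dom c p -> dom d p ->
  let T := 'J (transition c d) (coord c p) in
  g c (coord c p) = T *m g d (coord d p) *m T^T.
Proof.
move=> Sc Sd cp dp T.
by rewrite (metric_change g Sc Sd (overlap_coord cp dp)) transition_coord.
Qed.

End Charts.

(** * Chart independence of the symphonic density *)

Section Density.
Variables (R : realType) (m n : nat) (M : ptopologicalType) (N : topologicalType)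
  (SM : smooth_manifold R m M) (SN : smooth_manifold R n N)
  (g : riemannian_metric SM) (h : riemannian_metric SN).

(** Regularity of [psi] is required at the single point p, so that the formula serves the time
    slices of a variation as well as [phi]. *)
Lemma local_rep_change (psi : M -> N) c c' d d' p :
  atlas SM c -> atlas SM c' -> atlas SN d -> atlas SN d' ->
  dom c p -> dom c' p -> dom d (psi p) -> dom d' (psi p) ->
  {for p, continuous psi} -> differentiable (local_rep psi c d) (coord c p) ->
  differentiable (local_rep psi c' d') (coord c' p) /\
  'J (local_rep psi c' d') (coord c' p) =
    'J (transition c' c) (coord c' p) *m 'J (local_rep psi c d) (coord c p)
      *m 'J (transition d d') (coord d (psi p)).
Proof.
move=> Sc Sc' Sd Sd' cp c'p dp d'p cpsi df.
have d1 := transition_differentiable Sc' Sc c'p cp.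
have df' : differentiable (local_rep psi c d) (transition c' c (coord c' p)).
  by rewrite transition_coord.
have lE : local_rep psi c d (coord c p) = coord d (psi p) by rewrite /local_rep /= coordK.
have d2 : differentiable (transition d d') (local_rep psi c d (transition c' c (coord c' p))).
  by rewrite transition_coord// lE; exact: (transition_differentiable Sd Sd' dp d'p).
have d12 := differentiable_comp d1 df'.
have H : \forall u \near coord c' p,
    (transition d d' \o (local_rep psi c d \o transition c' c)) u = local_rep psi c' d' u.
  have H1 := near_param c'p (near_dom cp).
  have H2 : \forall u \near coord c' p, dom d (psi (param c' u)).
    exact: (near_param (O := psi @^-1` dom d) c'p (cpsi _ (near_dom dp))).
  near=> u; rewrite /transition /local_rep /= [param c _]coordK; last exact: (near H1 u).
  by rewrite coordK//; exact: (near H2 u).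
have [e1 e2] := near_eq_differentiable H (differentiable_comp d12 d2).
split; first exact: e1.
rewrite (near_eq_jacobian H (differentiable_comp d12 d2)) (jacobian_comp d12 d2).
rewrite (jacobian_comp d1 df') [(_ \o _) _]/=.
by rewrite (transition_coord _ c'p) lE.
Unshelve. all: by end_near. Qed.

(** This is [|phi^* h|^2] contracted with the inverse metric. Unlike an arbitrarily chosen
    orthonormal frame, which need not be continuous in the point, this expression is visibly smooth
    in G, H and J. *)
Definition pullback_norm2 (G : 'M[R]_m) (H : 'M[R]_n) (J : 'M[R]_(m, n)) : R :=
  \tr (invmx G *m (J *m H *m J^T) *m invmx G *m (J *m H *m J^T)).

(** Charts and frame in the density are picked separately at each point. Here they are exchanged for
    fixed charts near p: the frame disappears through completeness, the source transition through
    invariance of the trace, and the target transition through the transformation law of h. *)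
Lemma symphonic_density_chart (psi : M -> N) c d p :
  atlas SM c -> atlas SN d -> dom c p -> dom d (psi p) ->
  {for p, continuous psi} -> differentiable (local_rep psi c d) (coord c p) ->
  symphonic_density g h psi p =
  pullback_norm2 (g c (coord c p)) (h d (coord d (psi p)))
    ('J (local_rep psi c d) (coord c p)).
Proof.
move=> Sc Sd cp dp cpsi df; rewrite /symphonic_density.
set c' := chart_at SM p; set d' := chart_at SN (psi p).
have [Sc' c'p] : atlas SM c' /\ dom c' p by exact: chart_atP.
have [Sd' d'p] : atlas SN d' /\ dom d' (psi p) by exact: chart_atP.
have [df' JE] := local_rep_change Sc Sc' Sd Sd' cp c'p dp d'p cpsi df.
set T := 'J (transition c' c) (coord c' p) in JE *.
have uT : T \in unitmx by exact: (jacobian_transition_unit Sc' Sc c'p cp).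
set J := 'J (local_rep psi c d) _ in JE *.
set J' := 'J _ _ in JE *.
set D := 'J (transition d d') _ in JE *.
have GE : g c' (coord c' p) = T *m g c (coord c p) *m T^T by exact:
  (metric_transition g Sc' Sc c'p cp).
have HE : h d (coord d (psi p)) = D *m h d' (coord d' (psi p)) *m D^T.
  exact: (metric_transition h Sd Sd' dp d'p).
have [E0 EE0] := posdef_orthonormal (metric_symm g Sc' c'p) (metric_posdef g Sc' c'p).
have EE : orthonormal_frame (g c' (coord c' p)) *m g c' (coord c' p)
    *m (orthonormal_frame (g c' (coord c' p)))^T = 1%:M.
  by rewrite /orthonormal_frame; case: xgetP => [E _ //|/(_ E0)].
set E := orthonormal_frame _ in EE *.
have [uG' iG'] := invmx_orthonormal EE.
have sS : (J' *m h d' (coord d' (psi p)) *m J'^T)^T = J' *m h d' (coord d' (psi p)) *m J'^T.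
  by rewrite !trmx_mul trmxK metric_symm// mulmxA.
have SE : J' *m h d' (coord d' (psi p)) *m J'^T = T *m (J *m h d (coord d (psi p)) *m J^T) *m T^T.
  by rewrite HE JE !trmx_mul !mulmxA.
rewrite sum_sqr_mxtrace /pullback_norm2.
rewrite -(mxtrace_invmx_congr _ _ (metric_unit g Sc cp) uT) -GE -SE iG'.
have -> : E *m J' *m h d' (coord d' (psi p)) *m (E *m J')^T =
  E *m (J' *m h d' (coord d' (psi p)) *m J'^T) *m E^T by rewrite trmx_mul !mulmxA.
rewrite 2!trmx_mul trmxK sS !mulmxA [LHS]mxtrace_mulC !mulmxA.
by [].
Qed.

End Density.

(** * The Riemannian measure *)

Section IntegralRV.
Variable R : realType.

(** The integral of a nonnegative function is a supremum over the simple functions below it, so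
    monotonicity asks for no measurability. Iterated integrals can thus be compared without proving
    that the inner ones are measurable. *)
Lemma ge0_integral_mono d (T : measurableType d) (mu : {measure set T -> \bar R})
    (f1 f2 : T -> \bar R) : (forall x, 0 <= f1 x)%E -> (forall x, f1 x <= f2 x)%E ->
  (\int[mu]_x f1 x <= \int[mu]_x f2 x)%E.
Proof.
move=> f10 f12; have f20 x : (0 <= f2 x)%E by exact: le_trans (f12 x).
rewrite !ge0_integralTE//; apply: le_ereal_sup => _ [k /= kf <-].
by exists k => // x; exact: le_trans (f12 x).
Qed.

Lemma integral_rV_ge0 n (f : 'rV[R]_n -> \bar R) :
  (forall x, 0 <= f x)%E -> (0 <= integral_rV f)%E.
Proof.
elim: n f => [|n IH] f f0 /=; first exact: f0.
by apply: integral_ge0 => x _; exact: IH.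
Qed.

Lemma integral_rV_mono n (f1 f2 : 'rV[R]_n -> \bar R) :
  (forall x, 0 <= f1 x)%E -> (forall x, f1 x <= f2 x)%E ->
  (integral_rV f1 <= integral_rV f2)%E.
Proof.
elim: n f1 f2 => [|n IH] f1 f2 f10 f12 /=; first exact: f12.
apply: ge0_integral_mono => x; first exact: integral_rV_ge0.
exact: IH.
Qed.

Lemma ball_row_mx n (p : 'rV[R]_(1 + n)) (r x : R) (v : 'rV[R]_n) :
  ball p r (row_mx (x%:M : 'rV[R]_1) v) <->
  ball (p 0 (lshift n 0)) r x /\ ball (rsubmx p) r v.
Proof.
rewrite -!ball_normE /ball_ /=; split=> [H|[H1 H2]].
  have r0 : 0 < r by exact: le_lt_trans H.
  split.
    have := le_lt_trans (norm_entry_le _ 0 (lshift n 0)) H.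
    by rewrite !mxE (unsplitK (inl 0)) mxE mulr1n.
  apply: norm_mx_lt => // i j.
  have := le_lt_trans (norm_entry_le _ i (rshift 1 j)) H.
  by rewrite !mxE (unsplitK (inr j)).
have r0 : 0 < r by exact: le_lt_trans H1.
apply: norm_mx_lt => // i j; rewrite (ord1 i).
case: (split_ordP j) => k -> {j}.
  by rewrite (ord1 k) !mxE (unsplitK (inl 0)) mxE mulr1n.
rewrite !mxE (unsplitK (inr k)).
have := le_lt_trans (norm_entry_le _ 0 k) H2.
by rewrite !mxE.
Qed.

(** Balls of the sup norm are cubes, so the indicator is a product over the coordinates and each
    integration contributes the length 2r. *)
Lemma integral_rV_ball n (p : 'rV[R]_n) (r K : R) : 0 < r -> 0 <= K ->
  integral_rV (fun u => (K * \1_(ball p r) u)%:E) = (K * (r *+ 2) ^+ n)%:E.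
Proof.
move=> r0; elim: n p K => [|n IH] p K K0.
  rewrite /= indicE mem_set ?mulr1//.
  by rewrite -ball_normE /ball_ /= (_ : p - 0 = 0) ?normr0//; apply/rowP => -[].
rewrite /=.
pose p' : 'rV[R]_(1 + n) := p.
have E x : integral_rV (fun v : 'rV[R]_n => (K * \1_(ball p r) (row_mx
  (x%:M : 'rV[R]_1) v : 'rV[R]_n.+1))%:E)
  = ((K * (r *+ 2) ^+ n)%:E * (\1_(ball (p' 0 (lshift n 0)) r) x)%:E)%E.
  transitivity (integral_rV (fun v : 'rV[R]_n =>
      ((K * \1_(ball (p' 0 (lshift n 0)) r) x) * \1_(ball (rsubmx p') r) v)%:E)).
    congr integral_rV; apply/funext => v; congr (_%:E); rewrite -mulrA; congr (_ * _).
    rewrite !indicE -natrM mulnb; congr ((_ : bool)%:R).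
    apply/idP/andP; rewrite !inE.
      by move=> /ball_row_mx.
    by move=> H; apply/ball_row_mx.
  rewrite IH ?mulr_ge0// -EFinM; congr (_%:E); rewrite -!mulrA; congr (_ * _); exact: mulrC.
under eq_integral do rewrite E.
have K1 : (0 <= (K * (r *+ 2) ^+ n)%:E)%E.
  by rewrite lee_fin mulr_ge0// exprn_ge0// mulrn_wge0// ltW.
have I0 (x : R) : [set: R] x -> (0 <= (\1_(ball (p' 0 (lshift n 0)) r) x : R)%:E)%E.
  by move=> _; rewrite lee_fin indicE ler0n.
rewrite ge0_integralZl//; last first.
  by apply/measurable_EFinP; apply: measurable_indic; exact: measurable_ball.
rewrite integral_indic//; last exact: measurable_ball.
rewrite setIT; transitivity ((K * (r *+ 2) ^+ n)%:E * (r *+ 2)%:E)%E.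
  by congr (_ * _)%E; exact: lebesgue_measure_ball (ltW r0).
by rewrite -EFinM exprSr mulrA.
Qed.

End IntegralRV.

Section DetPositive.
Variable R : realType.

Lemma posdef_det_gt0 n (G : 'M[R]_n) : G^T = G -> posdef G -> 0 < \det G.
Proof.
move=> sG pG; have [E /(congr1 determinant)] := posdef_orthonormal sG pG.
rewrite !det_mulmx det_tr det1 mulrAC -expr2 => H.
have : 0 < \det E ^+ 2 * \det G by rewrite H.
by rewrite pmulr_rgt0// exprn_even_gt0//=; apply/eqP => E0; move: H;
  rewrite E0 expr0n mul0r => /eqP; rewrite eq_sym oner_eq0.
Qed.

Lemma Ck_prod (V : normedModType R) k (U : set V) (I : Type) (r : seq I)
    (F : I -> V -> R^o) :
  open U -> (forall i, Ck k U (F i)) -> Ck k U (fun x => \prod_(i <- r) (F i x : R) : R^o).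
Proof.
move=> oU cF; elim: r => [|i r IH].
  rewrite (_ : (fun _ => _) = cst 1); first exact: Ck_cst.
  by apply/funext => x; rewrite big_nil.
rewrite (_ : (fun _ => _) = fun x => (F i x : R) * \prod_(j <- r) (F j x : R) : R^o).
  exact: CkM.
by apply/funext => x; rewrite big_cons.
Qed.

Lemma Ck_det (V : normedModType R) k (U : set V) n (A : V -> 'M[R]_n) :
  open U -> Ck k U A -> Ck k U (fun x => \det (A x) : R^o).
Proof.
move=> oU cA; apply: Ck_sum => // s.
apply: CkM => //; first exact: Ck_cst.
apply: (@Ck_prod _ _ _ _ _ (fun i x => A x i (s i) : R^o)) => // i.
exact: (Ck_mxP _ _ oU).1 cA i _.
Qed.

End DetPositive.

Section RiemannianMeasure.
Variables (R : realType) (m : nat) (M : ptopologicalType) (S : smooth_manifold R m M)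
  (g : riemannian_metric S) (dv : {measure set (borel M) -> \bar R}).
Hypothesis dvP : is_riemannian_measure g dv.

Lemma open_borel (A : set M) : open A -> measurable (A : set (borel M)).
Proof. by move=> oA; exact: sub_sigma_algebra. Qed.

(** On a small coordinate cube around p the volume density lies between half its value at p and that
    value plus 1. Comparison with these constants bounds the measure on both sides: the upper bound
    leads to finite volume, the lower one to vanishing of continuous nonnegative functions with zero
    integral. *)
Lemma local_measure (p : M) (O : set M) : nbhs p O ->
  exists A : set M, [/\ open A, A p, A `<=` O & (0 < dv A < +oo)%E].
Proof.
move=> Op; have [Sc cp] := chart_atP S p; set c := chart_at S p in Sc cp.
set u := coord c p.
pose D (v : 'rV[R]_m) : R^o := Num.sqrt (\det (g c v)).
have Du : 0 < D u.
  by rewrite sqrtr_gt0; apply: posdef_det_gt0; [exact: metric_symm|exact: metric_posdef].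
have cD : {for u, continuous D}.
  apply: (@continuous_comp _ _ _ (fun v => \det (g c v) : R^o) (@Num.sqrt R : R^o -> R^o)).
    have C0 := Ck_det (open_img (c := c)) ((smooth_onP _ _).1 (metric_smooth g Sc) 0%N).
    exact: (Ck_cont C0 (img_coord cp)).
  exact: sqrt_continuous.
have N1 : \forall v \near u, D u / 2 < D v.
  have H : D u / 2 < D u by lra.
  exact: (cD _ (lt_nbhsr H)).
have N2 : \forall v \near u, D v < D u + 1.
  have H : D u < D u + 1 by lra.
  exact: (cD _ (lt_nbhsl H)).
have N3 := near_img cp.
have N4 : \forall v \near u, O (param c v) by exact: (near_param cp Op).
have NN : nbhs u (fun v => (D u / 2 < D v /\ D v < D u + 1) /\ (img c v /\ O (param c v))).
  exact: filterI (filterI N1 N2) (filterI N3 N4).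
have /nbhs_ballP[r r0 Hr] := NN.
have r0' : 0 < r by [].
pose A := [set q | dom c q /\ ball u r (coord c q)].
have oA : open A.
  rewrite openE => q [cq uq]; have H1 := near_dom cq.
  have H2 : \forall q' \near q, ball u r (coord c q').
    apply: (coord_continuous cq); apply: open_nbhs_nbhs; split=> //; exact: ball_open.
  exact: filterI H1 H2.
have imA : coord c @` A = ball u r.
  apply/seteqP; split=> [_ [q [cq uq] <-] //|v uv].
  have [_ [iv _]] := Hr v uv; have [cv vE] := imgP iv.
  by exists (param c v) => //; split=> //; rewrite vE.
have dvA := dvP Sc (open_borel oA) (fun q (Aq : A q) => Aq.1).
exists A; split=> //.
- by split=> //; exact: ballxx.
- move=> q [cq uq]; have [_ [_]] := Hr _ uq.
  by rewrite coordK.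
rewrite dvA imA; apply/andP; split.
  apply: (@lt_le_trans _ _ (integral_rV (fun v => (D u / 2 * \1_(ball u r) v)%:E))).
    rewrite integral_rV_ball//; last by rewrite divr_ge0// ltW.
    by rewrite lte_fin mulr_gt0 ?divr_gt0// exprn_gt0// mulrn_wgt0.
  apply: integral_rV_mono => v.
    by rewrite lee_fin mulr_ge0 ?divr_ge0 ?(ltW Du)// indicE ler0n.
  rewrite lee_fin indicE; have [uv|uv] := boolP (v \in (ball u r : set 'rV[R]_m));
    last by rewrite /= !mulr0.
  by move: uv; rewrite inE => /Hr[[+ _] _]; rewrite /= !mulr1 => /ltW.
apply: (@le_lt_trans _ _ (integral_rV (fun v => ((D u + 1) * \1_(ball u r) v)%:E))).
  apply: integral_rV_mono => v.
    by rewrite lee_fin mulr_ge0 ?sqrtr_ge0// indicE ler0n.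
  rewrite lee_fin indicE; have [uv|uv] := boolP (v \in (ball u r : set 'rV[R]_m));
    last by rewrite /= !mulr0.
  by move: uv; rewrite inE => /Hr[[_ +] _]; rewrite /= !mulr1 => /ltW.
by rewrite integral_rV_ball ?ltry// addr_ge0// ltW.
Qed.

Hypothesis cptM : compact [set: M].

Lemma finite_volume : (dv [set: M] < +oo)%E.
Proof.
(* The filter generated by the sets of finite volume stands in for the extraction
   of a finite subcover. *)
pose F : set_system (set M) := [set P | exists B : set M,
  [/\ open B, (dv B < +oo)%E & forall C, B `<=` C -> P C]].
have FF : Filter F.
  split.
  - by exists set0; split=> //; [exact: open0|rewrite measure0 ltry].
  - move=> P Q [B [oB fB BP]] [C [oC fC CQ]]; exists (B `|` C); split.
    + exact: openU.
    + have U2 : (dv (B `|` C) <= dv B + dv C)%E.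
        exact: (measureU2 dv (open_borel oB) (open_borel oC)).
      by apply: le_lt_trans U2 _; rewrite lte_add_pinfty.
    + move=> D BCD; split; [apply: BP|apply: CQ]; apply: subset_trans BCD.
        exact: subsetUl.
      exact: subsetUr.
  - by move=> P Q PQ [B [oB fB BP]]; exists B; split=> // C /BP /PQ.
have [] := (compact_near_coveringP _).1 cptM (set M) F (fun C x => C x) FF.
  move=> x _; have [A [oA Ax _ /andP[_ fA]]] := local_measure (@filterT _ (nbhs x) _).
  exists (A, [set C | A `<=` C]) => /=.
    split; first exact: open_nbhs_nbhs.
    by exists A; split.
  by move=> [y C] /= [Ay]; exact.
move=> B [oB fB BC]; apply: le_lt_trans fB.
have -> : [set: M] = B by apply/seteqP; split=> // q _; exact: (BC B).
by [].
Qed.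

Lemma continuous_borel (f : M -> R^o) : continuous f ->
  measurable_fun [set: borel M] (f : borel M -> R).
Proof.
move=> cf mD; apply: (measurability _ (RGenOInfty.measurableE R)) => //.
move=> /= _ [_ [x ->] <-]; rewrite setTI; apply: open_borel.
move/continuousP : cf; apply; exact: rray_open.
Qed.

Lemma continuous_bounded (f : M -> R^o) : continuous f ->
  exists C : R, forall p, `|f p| <= C.
Proof.
move=> cf; have [|D [rD HD]] := (compact_near_coveringP _).1 cptM R (pinfty_nbhs R)
  (fun C x => `|f x| <= C) _.
  move=> x _.
  have Hf : \forall y \near x, `|f x - f y| < 1.
    by have /cvgrPdist_lt := cf x; apply.
  exists ([set y | `|f x - f y| < 1], [set C | `|f x| + 1 < C]) => /=.
    by split=> //; apply: nbhs_pinfty_gt; exact: num_real.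
  move=> [y C] /= [fy fC]; apply: le_trans (ltW fC).
  rewrite -[f y](subKr (f x)); apply: le_trans (ler_normB _ _) _.
  by rewrite lerD2l ltW.
by exists (D + 1) => p; apply: (HD (D + 1)) => //; rewrite ltrDl.
Qed.

Lemma continuous_integrable (f : M -> R^o) : continuous f ->
  dv.-integrable [set: borel M] (EFin \o (f : borel M -> R)).
Proof.
move=> cf; have [C HC] := continuous_bounded cf.
apply: measurable_bounded_integrable => //.
- exact: finite_volume.
- exact: continuous_borel.
exists C; split; first exact: num_real.
by move=> D CD p _ /=; apply: le_trans (HC p) (ltW CD).
Qed.

(** If [f p > 0], then f exceeds [f p / 2] on an open set of positive measure, which bounds the
    integral away from 0. *)
Lemma Rintegral_eq0_continuous (f : M -> R^o) : continuous f -> (forall p, 0 <= f p) ->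
  \int[dv]_p (f : borel M -> R) p = 0 -> forall p, f p = 0.
Proof.
move=> cf f0 If p; apply/eqP; rewrite eq_le f0 andbT leNgt; apply/negP => fp.
have Of : nbhs p [set q | f p / 2 < f q].
  have H : f p / 2 < f p by lra.
  exact: (cf _ _ (lt_nbhsr H)).
have [A [oA Ap AO /andP[A0 Aoo]]] := local_measure Of.
have I0 : (\int[dv]_q (f q)%:E = 0)%E.
  have := integrable_fin_num (measurableT) (continuous_integrable cf).
  by move=> /fineK <-; rewrite -/(Rintegral _ _ _) If.
have : ((f p / 2)%:E * dv A <= \int[dv]_q (f q)%:E)%E.
  have K0 : (0 <= (f p / 2)%:E)%E by rewrite lee_fin divr_ge0// ltW.
  have I1 q : [set: borel M] q -> (0 <= (\1_A q : R)%:E)%E.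
    by move=> _; rewrite lee_fin indicE ler0n.
  rewrite -[A]setIT -integral_indic//; last exact: open_borel.
  rewrite -ge0_integralZl//; last first.
    by apply/measurable_EFinP; apply: measurable_indic; exact: open_borel.
  apply: ge0_integral_mono => q; first by rewrite mule_ge0// I1.
  rewrite -EFinM lee_fin indicE; have [qA|qA] := boolP (q \in A); last by rewrite /= mulr0.
  by move: qA; rewrite inE => /AO /ltW; rewrite /= mulr1.
by rewrite I0 leNgt mule_gt0// lte_fin divr_gt0.
Qed.

End RiemannianMeasure.

(** * The varied density *)

Section MatrixSmooth.
Variable R : realType.

Lemma Ck_local (V W : normedModType R) k (U : set V) (f : V -> W) :
  (forall x, U x -> exists U' : set V, [/\ open U', U' x & Ck k U' f]) -> Ck k U f.
Proof.
elim: k f => [|k IH] f H.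
  by split=> // x /H[U' [_ U'x cf]]; exact: (Ck_cont cf).
split=> [x /H[U' [_ U'x cf]]|v]; first exact: (Ck_cont cf).
split=> [x /H[U' [_ U'x cf]]|]; first exact: (Ck_derivable _ cf).
by apply: IH => x /H[U' [oU' U'x cf]]; exists U'; split=> //; exact: Ck_derive.
Qed.

Lemma open_preimage_Ck (V W : normedModType R) k (U : set V) (f : V -> W) (B : set W) :
  open U -> Ck k U f -> open B -> open [set x | U x /\ B (f x)].
Proof.
move=> oU cf oB; rewrite openE => x [Ux Bfx].
have H1 : \forall y \near x, U y by exact: open_nbhs_nbhs.
have H2 : \forall y \near x, B (f y) by apply: (Ck_cont cf Ux); exact: open_nbhs_nbhs.
exact: filterI H1 H2.
Qed.

Lemma CkV (V : normedModType R) k (U : set V) (f : V -> R^o) :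
  open U -> (forall x, U x -> f x != 0) -> Ck k U f -> Ck k U (fun x => (f x : R)^-1 : R^o).
Proof.
move=> oU f0; have cc j : Ck j U f -> forall x, U x -> {for x, continuous (fun x =>
  (f x : R)^-1 : R^o)}.
  by move=> cf x Ux; apply: continuousV; [exact: f0|exact: (Ck_cont cf)].
elim: k => [|k IH] cf; first by split=> //; exact: cc cf.
split=> [|v]; first exact: cc cf.
split=> [x Ux|]; first by apply: derivableV; [exact: f0|exact: (Ck_derivable _ cf)].
apply: (@Ck_congr _ _ _ _ _ (fun x => (- 1 : R) * ((f x : R)^-1 *
  ((f x : R)^-1 * 'D_v f x)) : R^o)) => //.
  move=> x Ux; rewrite [RHS]deriveV; [|exact: f0|exact: (Ck_derivable _ cf)].
  by rewrite mulN1r mulrA -expr2 exprVn scaleNr.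
have IH' := IH (CkW cf).
apply: CkM => //; first exact: Ck_cst.
by apply: CkM => //; apply: CkM => //; exact: Ck_derive.
Qed.

Lemma Ck_mulmx (V : normedModType R) k (U : set V) m n p
    (A : V -> 'M[R]_(m, n)) (B : V -> 'M[R]_(n, p)) :
  open U -> Ck k U A -> Ck k U B -> Ck k U (fun x => A x *m B x).
Proof.
move=> oU cA cB; apply/Ck_mxP => // i j.
rewrite (_ : (fun _ => _) = fun x => \sum_l A x i l * B x l j : R^o); last first.
  by apply/funext => x; rewrite mxE.
apply: Ck_sum => // l; apply: CkM => //.
  exact: (Ck_mxP _ _ oU).1 cA i l.
exact: (Ck_mxP _ _ oU).1 cB l j.
Qed.

Lemma Ck_trmx (V : normedModType R) k (U : set V) m n (A : V -> 'M[R]_(m, n)) :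
  open U -> Ck k U A -> Ck k U (fun x => (A x)^T).
Proof.
move=> oU cA; apply/Ck_mxP => // i j.
rewrite (_ : (fun _ => _) = fun x => A x j i : R^o); last first.
  by apply/funext => x; rewrite mxE.
exact: (Ck_mxP _ _ oU).1 cA j i.
Qed.

Lemma Ck_mxtrace (V : normedModType R) k (U : set V) n (A : V -> 'M[R]_n) :
  open U -> Ck k U A -> Ck k U (fun x => \tr (A x) : R^o).
Proof. by move=> oU cA; apply: Ck_sum => // i; exact: ((Ck_mxP _ _ oU).1 cA i i). Qed.

Lemma Ck_scale (V : normedModType R) k (U : set V) m n (a : V -> R^o)
    (A : V -> 'M[R]_(m, n)) :
  open U -> Ck k U a -> Ck k U A -> Ck k U (fun x => (a x : R) *: A x).
Proof.
move=> oU ca cA; apply/Ck_mxP => // i j.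
rewrite (_ : (fun _ => _) = fun x => (a x : R) * A x i j : R^o); last first.
  by apply/funext => x; rewrite mxE.
by apply: CkM => //; exact: (Ck_mxP _ _ oU).1 cA i j.
Qed.

Lemma Ck_invmx (V : normedModType R) k (U : set V) n (A : V -> 'M[R]_n) :
  open U -> (forall x, U x -> A x \in unitmx) -> Ck k U A ->
  Ck k U (fun x => invmx (A x)).
Proof.
move=> oU uA cA.
(* Cramer's rule: the entries of the inverse are rational in those of the matrix. *)
apply: (@Ck_congr _ _ _ _ _ (fun x => (\det (A x))^-1 *: \adj (A x))) => //.
  by move=> x /uA Ax; rewrite /invmx Ax.
apply: Ck_scale => //.
  apply: CkV => //; last exact: Ck_det.
  by move=> x /uA; rewrite unitmxE unitfE.
apply/Ck_mxP => // i j.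
rewrite (_ : (fun _ => _) = fun x => (-1) ^+ (j + i) * \det (row' j (col' i (A x))) : R^o);
  last first.
  by apply/funext => x; rewrite mxE.
apply: CkM => //; first exact: Ck_cst.
apply: Ck_det => //; apply/Ck_mxP => // a b.
rewrite (_ : (fun _ => _) = fun x => A x (lift j a) (lift i b) : R^o); last first.
  by apply/funext => x; rewrite !mxE.
exact: ((Ck_mxP _ _ oU).1 cA _ _).
Qed.

Lemma Ck_jacobian k m n (U : set 'rV[R]_m) (f : 'rV[R]_m -> 'rV[R]_n) :
  open U -> Ck k.+1 U f -> Ck k U (fun x => 'J f x).
Proof.
move=> oU cf; apply/Ck_mxP => // i j.
apply: (@Ck_congr _ _ _ _ _ (fun x => 'D_(delta_mx 0 i) f x 0 j : R^o)) => //.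
  move=> x Ux.
  have C1 : Ck 1 U f by move: cf; elim: (k) => // l IHl /CkW.
  have df := C1_differentiable oU C1 Ux.
  by rewrite (deriveEjacobian _ df) -rowE mxE.
exact: (Ck_mxP _ _ oU).1 (Ck_derive (delta_mx 0 i) cf) 0 j.
Qed.

Lemma Ck_fst (V W : normedModType R) k (U : set (V * W)) : Ck k U (fun z : V * W => z.1).
Proof.
have c : continuous (fst : {linear (V * W)%type -> V}) by move=> z; exact: cvg_fst.
exact: (Ck_lin k U c).
Qed.

Lemma Ck_snd (V W : normedModType R) k (U : set (V * W)) : Ck k U (fun z : V * W => z.2).
Proof.
have c : continuous (snd : {linear (V * W)%type -> W}) by move=> z; exact: cvg_snd.
exact: (Ck_lin k U c).
Qed.

Lemma Ck_pullback_norm2 (V : normedModType R) k (U : set V) m n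
    (G : V -> 'M[R]_m) (H : V -> 'M[R]_n) (J : V -> 'M[R]_(m, n)) :
  open U -> (forall x, U x -> G x \in unitmx) -> Ck k U G -> Ck k U H -> Ck k U J ->
  Ck k U (fun x => pullback_norm2 (G x) (H x) (J x) : R^o).
Proof.
move=> oU uG cG cH cJ; apply: Ck_mxtrace => //.
have cI := Ck_invmx oU uG cG.
have cS : Ck k U (fun x => J x *m H x *m (J x)^T).
  by apply: Ck_mulmx => //; [exact: Ck_mulmx|exact: Ck_trmx].
by apply: Ck_mulmx => //; apply: Ck_mulmx => //; exact: Ck_mulmx.
Qed.

(** The mean value theorem in the time direction. The error is controlled for all base points near w
    at once, which is the form that compactness can make uniform on M. *)
Lemma C1_expansion (V : normedModType R) (U : set (V * R^o)) (F : V * R^o -> R^o) w :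
  open U -> Ck 1 U F -> U (w, 0) -> forall e : R, 0 < e ->
  \forall z \near (w, 0 : R^o),
    `|F z - F (z.1, 0) - (z.2 : R) * 'D_((0, 1) : V * R^o) F (z.1, 0)| <= e * `|z.2 : R|.
Proof.
move=> oU cF Uw e e0; set D := 'D_((0, 1) : V * R^o) F.
have cD := Ck_cont (Ck_derive ((0, 1) : V * R^o) cF) Uw.
have HU : \forall z \near (w, 0 : R^o), U z by exact: open_nbhs_nbhs.
have HD : \forall z \near (w, 0 : R^o), `|D (w, 0) - D z| < e / 2.
  by have /cvgrPdist_lt := cD; apply; rewrite divr_gt0.
have HH : nbhs (w, 0 : R^o) (fun z => U z /\ `|D (w, 0) - D z| < e / 2) by exact: filterI HU HD.
have /nbhs_ballP[r r0 Hr] := HH.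
apply/nbhs_ballP; exists r => // -[v t] [/= wv zt].
have Bs (s : R) : 0 <= s <= 1 -> ball (w, 0 : R^o) r ((v, 0) + s *: (t *: (0, 1)) : V * R^o).
  move=> /andP[s0 s1]; split=> /=.
    by rewrite scaler0 scaler0 addr0.
  move: zt; rewrite -!ball_normE /ball_ /= !sub0r !normrN add0r => zt.
  apply: le_lt_trans zt; rewrite normrM (ger0_norm s0) [t *: 1]mulr1.
  by rewrite ler_piMl.
have [|s s01] := @MVT_dir _ _ F (v, 0) (t *: (0, 1)).
  move=> s /Bs /Hr[Us _]; split; first exact: (Ck_cont cF Us).
  exact: (Ck_derivable _ cF Us).
have -> : (v, 0) + t *: (0, 1) = (v, t) :> V * R^o.
  by congr (_, _) => /=; rewrite ?scaler0 ?addr0// add0r [_ *: _]mulr1.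
have [Us Ds] := Hr _ (Bs s s01).
have [U0 D0] : U (v, 0) /\ `|D (w, 0) - D (v, 0)| < e / 2.
  by have := Hr _ (Bs 0 _); rewrite scale0r addr0 lexx ler01; apply.
rewrite /= => ->; have [_ ->] := is_derive_dirZ t (Ck_derivable ((0, 1) : V * R^o) cF Us).
rewrite -/D -mulrBr normrM mulrC ler_wpM2r//.
(* The derivatives at the intermediate time and at time 0 are both compared with the one at
   [(w, 0)], each at the cost of [e / 2]. *)
rewrite -[X in X - _](subrK (D (w, 0))) -addrA.
apply: le_trans (ler_normD _ _) _; rewrite (distrC (D _)).
by apply: ltW; rewrite [ltRHS]splitr ltrD.
Qed.

End MatrixSmooth.

(** * Derivatives of matrix expressions *)

Section MatrixDerive.
Variables (R : realType) (V : normedModType R).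

Lemma is_derive_mxP m n (A : V -> 'M[R]_(m, n)) x v (dA : 'M[R]_(m, n)) :
  is_derive x v A dA <->
  forall i j, is_derive x v (fun y => A y i j : R^o) (dA i j : R^o).
Proof.
split=> [[d1 d2] i j|H].
  split; first exact: ((derivable_mxP _ _ _).1 d1 i j).
  by rewrite -d2 derive_mx// mxE.
have d1 : derivable A x v by apply/derivable_mxP => i j; have [] := H i j.
split=> //; rewrite derive_mx//; apply/matrixP => i j; rewrite mxE.
by have [_] := H i j.
Qed.

Lemma is_derive_sumr (I : Type) (r : seq I) (F : I -> V -> R^o) (dF : I -> R^o) x v :
  (forall i, is_derive x v (F i) (dF i)) ->
  is_derive x v (fun y => \sum_(i <- r) F i y) (\sum_(i <- r) dF i).
Proof.
move=> H; elim: r => [|i r IH].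
  rewrite big_nil (_ : (fun _ => _) = cst 0); first exact: is_derive_cst.
  by apply/funext => y; rewrite big_nil.
rewrite big_cons (_ : (fun _ => _) = F i + (fun y => \sum_(j <- r) F j y)).
  exact: is_deriveD.
by apply/funext => y; rewrite big_cons.
Qed.

Lemma is_derive_mulr (f g : V -> R^o) x v (df dg : R^o) :
  is_derive x v f df -> is_derive x v g dg ->
  is_derive x v (fun y => (f y : R) * g y : R^o) ((df : R) * g x + (f x : R) * dg : R^o).
Proof.
move=> Hf Hg; apply: (is_derive_eq (is_deriveM Hf Hg)).
by rewrite addrC; congr (_ + _); exact: mulrC.
Qed.

Lemma is_derive_mulmx m n p (A : V -> 'M[R]_(m, n)) (B : V -> 'M[R]_(n, p)) x v dA dB :
  is_derive x v A dA -> is_derive x v B dB ->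
  is_derive x v (fun y => A y *m B y) (dA *m B x + A x *m dB).
Proof.
move=> /is_derive_mxP HA /is_derive_mxP HB; apply/is_derive_mxP => i j.
rewrite (_ : (fun _ => _) = fun y => \sum_l A y i l * B y l j : R^o); last first.
  by apply/funext => y; rewrite mxE.
rewrite !mxE -big_split; apply: is_derive_sumr => l.
exact: (is_derive_mulr (HA i l) (HB l j)).
Qed.

Lemma is_derive_trmx m n (A : V -> 'M[R]_(m, n)) x v dA :
  is_derive x v A dA -> is_derive x v (fun y => (A y)^T) dA^T.
Proof.
move=> /is_derive_mxP HA; apply/is_derive_mxP => i j; rewrite mxE.
rewrite (_ : (fun _ => _) = fun y => A y j i : R^o); first exact: HA.
by apply/funext => y; rewrite mxE.
Qed.

Lemma is_derive_mxtrace n (A : V -> 'M[R]_n) x v dA :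
  is_derive x v A dA -> is_derive x v (fun y => \tr (A y) : R^o) (\tr dA : R^o).
Proof. by move=> /is_derive_mxP HA; apply: is_derive_sumr => i; exact: HA. Qed.

(** For symmetric G and B this is the inner product of A and B induced by the metric G on bilinear
    forms. *)
Definition form_dot m (G A B : 'M[R]_m) : R := \tr (invmx G *m A *m invmx G *m B).

(** The metric of M stays fixed, so only the pulled back form [J H J^T] varies; the two terms of the
    product rule agree by cyclicity of the trace, whence the factor 2. *)
Lemma is_derive_pullback_norm2 m n (G : 'M[R]_m) (H : V -> 'M[R]_n)
    (J : V -> 'M[R]_(m, n)) x v dH dJ :
  is_derive x v H dH -> is_derive x v J dJ ->
  is_derive x v (fun y => pullback_norm2 G (H y) (J y) : R^o)
    (2 * form_dot G (dJ *m H x *m (J x)^T + J x *m dH *m (J x)^T + J x *m H x *m dJ^T)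
       (J x *m H x *m (J x)^T) : R^o).
Proof.
move=> HH HJ; pose S y := J y *m H y *m (J y)^T.
pose dS := dJ *m H x *m (J x)^T + J x *m dH *m (J x)^T + J x *m H x *m dJ^T.
have HS : is_derive x v S dS.
  apply: (is_derive_eq (is_derive_mulmx (is_derive_mulmx HJ HH) (is_derive_trmx HJ))).
  by rewrite mulmxDl.
have HG : is_derive x v (cst (invmx G) : V -> 'M[R]_m) 0 by exact: is_derive_cst.
have HGS : is_derive x v (fun y => invmx G *m S y) (invmx G *m dS).
  by apply: (is_derive_eq (is_derive_mulmx HG HS)); rewrite mul0mx add0r.
have HGSG : is_derive x v (fun y => invmx G *m S y *m invmx G) (invmx G *m dS *m invmx G).
  by apply: (is_derive_eq (is_derive_mulmx HGS HG)); rewrite mulmx0 addr0.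
apply: (is_derive_eq (is_derive_mxtrace (is_derive_mulmx HGSG HS))).
rewrite -/dS -/(S x) /form_dot mxtraceD mulr2n mulrDl !mul1r; congr (_ + _).
by rewrite -(mulmxA (invmx G *m S x)) mxtrace_mulC !mulmxA.
Qed.

End MatrixDerive.

Section FormDot.
Variables (R : realType) (m : nat).
Implicit Types G A B : 'M[R]_m.

Lemma form_dotDl G A A' B : form_dot G (A + A') B = form_dot G A B + form_dot G A' B.
Proof. by rewrite /form_dot mulmxDr !mulmxDl mxtraceD. Qed.

Lemma form_dotZl G a A B : form_dot G (a *: A) B = a * form_dot G A B.
Proof. by rewrite /form_dot -scalemxAr -!scalemxAl mxtraceZ. Qed.

Lemma form_dot0l G B : form_dot G 0 B = 0.
Proof. by rewrite /form_dot mulmx0 !mul0mx mxtrace0. Qed.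

End FormDot.

Lemma is_derive_affine (R : realType) m n (A B : 'M[R]_(m, n)) (t : R) :
  is_derive t 1 (fun s : R => A + s *: B) B.
Proof.
apply/is_derive_mxP => i j.
have dl : is_derive t 1 (cst (A i j) + (B i j \*: id) : R -> R^o) (0 + B i j *: (1 : R)).
  exact: is_deriveD.
rewrite (_ : (fun _ => _) = (cst (A i j) + (B i j \*: id) : R -> R^o)); last first.
  by apply/funext => s; rewrite !mxE; congr (_ + _); exact: mulrC.
by apply: (is_derive_eq dl); rewrite add0r [_ *: 1]mulr1.
Qed.

(** With L the Jacobian of [xi] and dH the derivative of h along [xi], the bracket
    [dH + L H + H L^T] is the Lie derivative in matrix form. The matrix a carries the derivative of
    the cutoff. *)
Lemma pullback_variation (R : realType) m n (a J : 'M[R]_(m, n)) (H dH L : 'M[R]_n) (f : R) :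
  (a + f *: (J *m L)) *m H *m J^T + J *m (f *: dH) *m J^T
    + J *m H *m (a + f *: (J *m L))^T =
  f *: (J *m (dH + L *m H + H *m L^T) *m J^T) + (a *m H *m J^T + J *m H *m a^T).
Proof.
have -> : (a + f *: (J *m L))^T = a^T + f *: (L^T *m J^T).
  by rewrite [LHS]linearD /= linearZ /= trmx_mul.
rewrite !(mulmxDl, mulmxDr).
rewrite -!(scalemxAl, scalemxAr) !scalerDr !mulmxA.
by rewrite (AC (3*2) ((3*2*5)*(1*4))).
Qed.

(** * The first variation of the density in fixed charts *)

Section LocalVariation.
Variables (R : realType) (m n : nat) (M : ptopologicalType) (N : topologicalType)
  (SM : smooth_manifold R m M) (SN : smooth_manifold R n N)
  (g : riemannian_metric SM) (h : riemannian_metric SN) (xi : vector_field SN)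
  (phi : M -> N) (c : chart R m M) (d : chart R n N) (chi : M -> R).
Hypotheses (Sc : atlas SM c) (Sd : atlas SN d) (phiS : smooth_map SM SN phi).

Definition chart_domain : set 'rV[R]_m :=
  [set w | img c w /\ dom d (phi (param c w))].

Definition map_rep : 'rV[R]_m -> 'rV[R]_n := local_rep phi c d.

Definition cutoff_rep (w : 'rV[R]_m) : R^o := chi (param c w).

Definition field_rep (w : 'rV[R]_m) : 'rV[R]_n := xi d (map_rep w).

Definition varied_rep (z : 'rV[R]_m * R^o) : 'rV[R]_n :=
  map_rep z.1 + ((z.2 : R) * cutoff_rep z.1) *: field_rep z.1.

(** The Jacobian in w of the moved map, written as an affine function of time, so that joint
    smoothness in w and t is immediate. *)
Definition varied_jacobian (z : 'rV[R]_m * R^o) : 'M[R]_(m, n) :=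
  'J map_rep z.1 + (z.2 : R) *: 'J (fun w => cutoff_rep w *: field_rep w) z.1.

Definition variation_domain : set ('rV[R]_m * R^o) :=
  [set z | chart_domain z.1 /\ img d (varied_rep z)].

Definition varied_density (z : 'rV[R]_m * R^o) : R^o :=
  pullback_norm2 (g c z.1) (h d (varied_rep z)) (varied_jacobian z).

Hypothesis chiS : smooth_on (img c) cutoff_rep.

Lemma open_chart_domain : open chart_domain.
Proof.
apply: (open_chart_preimage (O := phi @^-1` dom d)).
by have /continuousP := phiS.1; apply; exact: open_dom.
Qed.

Lemma map_rep_img w : chart_domain w -> img d (map_rep w).
Proof. by move=> [_ dw]; exact: img_coord. Qed.

Lemma Ck_map_rep k : Ck k chart_domain map_rep.
Proof. exact: (smooth_onP _ _).1 (phiS.2 c d Sc Sd) k. Qed.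

Lemma Ck_cutoff_rep k : Ck k chart_domain cutoff_rep.
Proof. by apply: Ck_sub ((smooth_onP _ _).1 chiS k) => w []. Qed.

Lemma Ck_field_rep k : Ck k chart_domain field_rep.
Proof.
apply: (Ck_comp open_chart_domain (open_img (c := d)) map_rep_img (Ck_map_rep k)).
exact: (smooth_onP _ _).1 (field_smooth xi Sd) k.
Qed.

Lemma Ck_cutoff_field_rep k : Ck k chart_domain (fun w => cutoff_rep w *: field_rep w).
Proof. exact: (Ck_scale open_chart_domain (Ck_cutoff_rep k) (Ck_field_rep k)). Qed.

Let strip : set ('rV[R]_m * R^o) := [set z | setT z /\ chart_domain z.1].

Let open_strip : open strip.
Proof.
exact: (open_preimage_Ck (k := 0%N) openT (Ck_fst _ _) open_chart_domain).
Qed.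

Let Ck_on_strip k p q (f : 'rV[R]_m -> 'M[R]_(p, q)) :
  Ck k chart_domain f -> Ck k strip (fun z : 'rV[R]_m * R^o => f z.1).
Proof.
move=> cf; apply: (Ck_comp open_strip open_chart_domain) cf; last exact: Ck_fst.
by move=> z [].
Qed.

Let Ck_on_strip_scalar k (f : 'rV[R]_m -> R^o) :
  Ck k chart_domain f -> Ck k strip (fun z : 'rV[R]_m * R^o => f z.1).
Proof.
move=> cf; apply: (Ck_comp_scalar open_strip open_chart_domain) cf; last exact: Ck_fst.
by move=> z [].
Qed.

Lemma Ck_varied_rep k : Ck k strip varied_rep.
Proof.
apply: CkD => //; first exact: Ck_on_strip (Ck_map_rep k).
apply: Ck_scale => //; last exact: Ck_on_strip (Ck_field_rep k).
by apply: CkM => //; [exact: Ck_snd|exact: Ck_on_strip_scalar (Ck_cutoff_rep k)].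
Qed.

Lemma open_variation_domain : open variation_domain.
Proof.
have := open_preimage_Ck open_strip (Ck_varied_rep 0) (open_img (c := d)).
congr open; apply/seteqP; split=> z [].
  by move=> [].
by move=> ? ?; split.
Qed.

Lemma variation_domain0 w : chart_domain w -> variation_domain (w, 0).
Proof.
move=> Uw; split=> //; rewrite /varied_rep /= mul0r scale0r addr0.
exact: map_rep_img.
Qed.

Lemma Ck_varied_density k : Ck k variation_domain varied_density.
Proof.
have oW := open_variation_domain.
have sW : variation_domain `<=` strip by move=> z [].
apply: Ck_pullback_norm2 => //.
- by move=> z [[[p cp <-] _] _]; exact: (metric_unit g Sc cp).
- apply: Ck_sub sW _; apply: (Ck_on_strip (f := g c)).
  by apply: Ck_sub ((smooth_onP _ _).1 (metric_smooth g Sc) k) => w [].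
- apply: (Ck_comp oW (open_img (c := d))).
  + by move=> z [].
  + exact: Ck_sub sW (Ck_varied_rep k).
  + exact: (smooth_onP _ _).1 (metric_smooth h Sd) k.
- apply: Ck_sub sW _; apply: CkD => //.
    apply: (Ck_on_strip (f := fun w => 'J map_rep w)).
    exact: Ck_jacobian open_chart_domain (Ck_map_rep k.+1).
  apply: Ck_scale => //; first exact: Ck_snd.
  apply: (Ck_on_strip (f := fun w => 'J (fun w => cutoff_rep w *: field_rep w) w)).
  exact: Ck_jacobian open_chart_domain (Ck_cutoff_field_rep k.+1).
Qed.

Definition gradient (f : 'rV[R]_m -> R) (w : 'rV[R]_m) : 'rV[R]_m :=
  \row_i partial i f w.

Lemma jacobian_cutoff_field w : chart_domain w ->
  'J (fun w => cutoff_rep w *: field_rep w) w =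
  (gradient cutoff_rep w)^T *m field_rep w +
  cutoff_rep w *: ('J map_rep w *m 'J (xi d) (map_rep w)).
Proof.
move=> Uw.
have dV : differentiable field_rep w.
  exact: (@C1_differentiable _ _ _ _ _ _ open_chart_domain (Ck_field_rep 1) Uw).
have dy : differentiable map_rep w.
  exact: (@C1_differentiable _ _ _ _ _ _ open_chart_domain (Ck_map_rep 1) Uw).
have dx : differentiable (xi d) (map_rep w).
  have C1 := (smooth_onP _ _).1 (field_smooth xi Sd) 1%N.
  exact: (@C1_differentiable _ _ _ _ _ _ (open_img (c := d)) C1 (map_rep_img Uw)).
have dfV : differentiable (fun w => cutoff_rep w *: field_rep w) w.
  exact: (@C1_differentiable _ _ _ _ _ _ open_chart_domain (Ck_cutoff_field_rep 1) Uw).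
rewrite -(jacobian_comp dy dx) -[xi d \o map_rep]/field_rep.
apply/matrixP => i j; rewrite (jacobianE _ _ dfV).
rewrite (_ : (fun y => _) = fun y => (cutoff_rep y : R) * field_rep y 0 j : R^o); last first.
  by apply/funext => y; rewrite mxE.
have D1 := derivableP (Ck_derivable (delta_mx 0 i) (Ck_cutoff_rep 1) Uw).
have D2 := derivableP (Ck_derivable (delta_mx 0 i) ((Ck_mxP _ _ open_chart_domain).1
  (Ck_field_rep 1) 0 j) Uw).
have [_ ->] := is_derive_mulr D1 D2.
move: (jacobianE i j dV); move: ('J field_rep w) => JV JE.
by rewrite !mxE big_ord1 !mxE JE.
Qed.

Lemma is_derive_metric_line w : chart_domain w ->
  is_derive (0 : R) 1 (fun s : R => h d (map_rep w + s *: (cutoff_rep w *: field_rep w)))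
    (cutoff_rep w *: \matrix_(i, j) \sum_k field_rep w 0 k * partial k (fun u => h d u i j)
      (map_rep w)).
Proof.
move=> Uw; set v := cutoff_rep w *: field_rep w.
have C1 := (smooth_onP _ _).1 (metric_smooth h Sd) 1%N.
have iy := map_rep_img Uw.
have dl := @is_derive_line _ _ _ (h d) (map_rep w) v 0.
rewrite scale0r addr0 in dl.
have dh : derivable (h d) (map_rep w) v by exact: (Ck_derivable v C1 iy).
apply: (is_derive_eq (dl dh)); rewrite derive_mx//; apply/matrixP => i j; rewrite !mxE.
have C1ij := (Ck_mxP _ _ (open_img (c := d))).1 C1 i j.
have [d1 d2] := C1_diff (open_img (c := d)) C1ij iy.
rewrite deriveE// d2 mulr_sumr; apply: eq_bigr => k _.
by rewrite !mxE mulrA.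
Qed.

(** The motion of the base point differentiates h, the motion of the Jacobian differentiates [xi]
    and the cutoff; the parts carrying the cutoff undifferentiated combine into the Lie derivative.
    No second derivative of [phi] appears. Symmetry of h identifies the second gradient term as the
    transpose of X. *)
Lemma varied_density_derive w : chart_domain w ->
  let J := 'J map_rep w in let H := h d (map_rep w) in
  let X := (gradient cutoff_rep w)^T *m field_rep w *m H *m J^T in
  'D_((0, 1) : 'rV[R]_m * R^o) varied_density (w, 0) =
  2 * (cutoff_rep w * form_dot (g c w) (J *m lie_metric xi h d (map_rep w) *m J^T)
    (J *m H *m J^T) +
       form_dot (g c w) (X + X^T) (J *m H *m J^T)).
Proof.
move=> Uw J H X.
have DV := Ck_derivable ((0, 1) : 'rV[R]_m * R^o) (Ck_varied_density 1) (variation_domain0 Uw).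
have := @is_derive_line _ _ _ varied_density (w, 0) ((0, 1) : 'rV[R]_m * R^o) 0.
rewrite scale0r addr0 => /(_ DV)[_ <-].
set K := 'J (fun w => cutoff_rep w *: field_rep w) w.
rewrite (_ : (fun s : R => _) = fun s : R =>
    pullback_norm2 (g c w) (h d (map_rep w + s *: (cutoff_rep w *: field_rep w))) (J + s *: K));
      last first.
  apply/funext => s; rewrite /varied_density /varied_rep /varied_jacobian /= scaler0 addr0.
  by rewrite add0r [s *: 1]mulr1 scalerA.
have HJ := is_derive_affine J K 0.
have [_ ->] := is_derive_pullback_norm2 (g c w) (is_derive_metric_line Uw) HJ.
rewrite !scale0r !addr0 -/H.
set dH := \matrix_(i, j) _; set f := cutoff_rep w.
congr (_ * _); rewrite -form_dotZl -form_dotDl; congr (form_dot _ _ _).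
have sH : H^T = H by apply: metric_sym => //; exact: map_rep_img.
have LE : lie_metric xi h d (map_rep w) =
    dH + 'J (xi d) (map_rep w) *m H + H *m ('J (xi d) (map_rep w))^T.
  have dx : differentiable (xi d) (map_rep w).
    have C1 := (smooth_onP _ _).1 (field_smooth xi Sd) 1%N.
    exact: (@C1_differentiable _ _ _ _ _ _ (open_img (c := d)) C1 (map_rep_img Uw)).
  have := fun i j => jacobianE i j dx; move: ('J (xi d) (map_rep w)) => Jx JE.
  apply/matrixP => i j; rewrite !mxE -!big_split; apply: eq_bigr => k _ /=.
  rewrite [Jx^T k j]mxE !JE; congr (_ + _ + _); exact: mulrC.
rewrite /K (jacobian_cutoff_field Uw) LE -/J -/f.
set Jx := 'J (xi d) _; set a := (gradient cutoff_rep w)^T *m field_rep w in X *.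
have -> : X^T = J *m H *m a^T by rewrite /X !trmx_mul trmxK sH !mulmxA.
exact: pullback_variation.
Qed.

End LocalVariation.

(** * Variations along a cut-off vector field *)

Section Variation.
Variables (R : realType) (m n : nat) (M : ptopologicalType) (N : topologicalType)
  (SM : smooth_manifold R m M) (SN : smooth_manifold R n N)
  (g : riemannian_metric SM) (h : riemannian_metric SN) (xi : vector_field SN)
  (phi : M -> N) (d : chart R n N) (chi : M -> R) (K : set M).
Hypotheses (Sd : atlas SN d) (phiS : smooth_map SM SN phi)
  (chiS : forall c, atlas SM c -> smooth_on (img c) (cutoff_rep c chi))
  (closedK : closed K) (KD : forall p, K p -> dom d (phi p))
  (chiK : forall p, ~ K p -> chi p = 0) (cptM : compact [set: M]).

Definition varied_coord (p : M) (t : R) : 'rV[R]_n :=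
  coord d (phi p) + (t * chi p) *: xi d (coord d (phi p)).

(** Outside the preimage of the chart domain the chart formula is meaningless and [phi] is kept. The
    complement of K and the preimage of the chart domain are open and cover M, and both branches
    agree on their intersection, where the cutoff vanishes. *)
Definition variation (p : M) (t : R) : N :=
  if `[< dom d (phi p) >] then param d (varied_coord p t) else phi p.

Lemma continuous_phi : continuous phi. Proof. exact: phiS.1. Qed.

Lemma open_phi_preimage (O : set N) : open O -> open (phi @^-1` O).
Proof. by move=> oO; have /continuousP := continuous_phi; apply. Qed.

Lemma local_rep_differentiable c d' p : atlas SM c -> atlas SN d' ->
  dom c p -> dom d' (phi p) -> differentiable (local_rep phi c d') (coord c p).
Proof.
move=> Sc Sd' cp dp.
have C1 := Ck_map_rep Sc Sd' phiS 1.
have Up : chart_domain phi c d' (coord c p).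
  by split; [exact: img_coord|rewrite coordK].
exact: (@C1_differentiable _ _ _ _ _ _ (open_chart_domain (c := c) (d := d') phiS) C1 Up).
Qed.

Lemma coord_chart_domain (c : chart R m M) (d' : chart R n N) p : dom c p -> dom d' (phi p) ->
  chart_domain phi c d' (coord c p).
Proof. by move=> cp dp; split; [exact: img_coord|rewrite coordK]. Qed.

Lemma varied_coordE (c : chart R m M) p t : dom c p ->
  varied_rep xi phi c d chi (coord c p, t) = varied_coord p t.
Proof.
move=> cp.
by rewrite /varied_rep /field_rep /cutoff_rep /map_rep /local_rep /= coordK.
Qed.

Lemma varied_coord_notK p t : ~ K p -> varied_coord p t = coord d (phi p).
Proof. by move=> /chiK cp; rewrite /varied_coord cp mulr0 scale0r addr0. Qed.

Lemma variation_dom p t : dom d (phi p) -> variation p t = param d (varied_coord p t).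
Proof. by move=> dp; rewrite /variation asboolT. Qed.

Lemma variation_notK p t : ~ K p -> variation p t = phi p.
Proof.
move=> Kp; rewrite /variation; case: asboolP => // dp.
by rewrite varied_coord_notK// coordK.
Qed.

Lemma variation0 p : variation p 0 = phi p.
Proof.
rewrite /variation; case: asboolP => // dp.
by rewrite /varied_coord mul0r scale0r addr0 coordK.
Qed.

Lemma near_notK p : ~ K p -> nbhs p (~` K).
Proof. by move=> Kp; apply: open_nbhs_nbhs; split=> //; rewrite openC. Qed.

Lemma near_coord_prod (c : chart R m M) p (P : 'rV[R]_m * R^o -> Prop) (t : R^o) : dom c p ->
  (\forall z \near (coord c p, t), P z) ->
  \forall q \near p & s \near t, P (coord c q, s).
Proof.
move=> cp [[A B] [/= nA nB] AB].
exists (coord c @^-1` A, B); first by split=> //; exact: (coord_continuous cp).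
by move=> [q s] /= [Aq Bs]; apply: AB.
Qed.

(** Around each point of the preimage of the chart domain, openness of [variation_domain] gives a
    local time, and compactness of M makes it uniform on K. Off K the point does not move, so every
    time is admissible there. *)
Lemma ex_variation_time : exists2 e : R, 0 < e &
  forall p t, dom d (phi p) -> `|t| < e -> img d (varied_coord p t).
Proof.
have [|e e0 He] := (compact_near_coveringP _).1 cptM R^o (nbhs (0 : R^o))
  (fun t p => K p -> img d (varied_coord p t)) _.
  move=> p _; have [dp|dp] := pselect (dom d (phi p)); last first.
    have Kp : ~ K p by move=> /KD.
    exists (~` K, setT); first by split; [exact: near_notK|exact: filterT].
    by move=> [q t] [].
  have [Sc cp] := chart_atP SM p; set c := chart_at SM p in Sc cp.
  have W0 := variation_domain0 xi chi (coord_chart_domain cp dp).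
  have oW := open_variation_domain (xi := xi) Sc Sd phiS (chiS Sc).
  have := near_coord_prod cp (open_nbhs_nbhs (conj oW W0)).
  move=> [[A B] [/= nA nB] AB].
  exists (A `&` dom c, B); first by split=> //; apply: filterI => //; exact: near_dom.
  move=> [q t] /= [[Aq cq] Bt] _.
  by rewrite -(varied_coordE _ cq); have [] := AB (q, t) (conj Aq Bt).
exists e => // p t dp te; have [Kp|Kp] := pselect (K p).
  by apply: (He t) => //; rewrite /= sub0r normrN.
by rewrite varied_coord_notK//; exact: img_coord.
Qed.

Variable e : R.
Hypotheses (e0 : 0 < e)
  (eP : forall p t, dom d (phi p) -> `|t| < e -> img d (varied_coord p t)).

Lemma variation_img p t : dom d (phi p) -> `|t| < e ->
  dom d (variation p t) /\ coord d (variation p t) = varied_coord p t.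
Proof. by move=> dp te; rewrite variation_dom//; exact: imgP (eP dp te). Qed.

Lemma variation_domainP (c : chart R m M) p t : dom c p -> dom d (phi p) -> `|t| < e ->
  variation_domain xi phi c d chi (coord c p, t).
Proof.
move=> cp dp te; split; first exact: coord_chart_domain.
by rewrite varied_coordE//; exact: eP.
Qed.

Lemma continuous_variation p t : `|t| < e ->
  {for (p, t), continuous (fun z : M * R => variation z.1 z.2)}.
Proof.
move=> te; have [dp|dp] := pselect (dom d (phi p)); last first.
  have Kp : ~ K p by move=> /KD.
  have H : \forall z \near (p, t), phi z.1 = variation z.1 z.2.
    exists (~` K, setT); first by split; [exact: near_notK|exact: filterT].
    by move=> [q s] [/= Kq _]; rewrite variation_notK.
  apply: (near_eq_continuous H).
  apply: (@continuous_comp _ _ _ (fst : M * R -> M) phi); first exact: cvg_fst.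
  exact: continuous_phi.
have [Sc cp] := chart_atP SM p; set c := chart_at SM p in Sc cp.
have H : \forall z \near (p, t),
    param d (varied_rep xi phi c d chi (coord c z.1, z.2)) = variation z.1 z.2.
  exists (dom c `&` phi @^-1` dom d, setT).
    split; last exact: filterT.
    apply: filterI; first exact: near_dom.
    by apply: open_nbhs_nbhs; split=> //; apply: open_phi_preimage; exact: open_dom.
  by move=> [q s] [/= [cq dq] _]; rewrite varied_coordE// variation_dom.
apply: (near_eq_continuous H).
apply: (@continuous_comp _ _ _ (fun z : M * R => varied_rep xi phi c d chi (coord c z.1, z.2))
  (param d)).
  apply: (@continuous_comp _ _ _ (fun z : M * R => (coord c z.1, z.2 : R^o))
    (varied_rep xi phi c d chi)).
    move=> P /= [[A B] [/= nA nB] AB].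
    exists (coord c @^-1` A, B); first by split=> //; exact: (coord_continuous cp).
    by move=> [q s] /= [Aq Bs]; apply: AB.
  apply: (Ck_cont (Ck_varied_rep xi Sc Sd phiS (chiS Sc) 0)).
  by split=> //; exact: coord_chart_domain.
by apply: param_continuous; rewrite varied_coordE//; exact: eP.
Qed.

(** Smoothness is local. Over the preimage of the chart domain the map is the affine formula
    followed by a transition to the target chart; elsewhere one is off K and the map is [phi],
    independent of time. *)
Lemma smooth_variation_variation : smooth_variation SM SN phi e variation.
Proof.
split=> //; first exact: variation0.
  by move=> p t te; exact: continuous_variation.
move=> c d' Sc Sd'; apply/smooth_onP => k; apply: Ck_local => -[w t] /= [cw te dw].
have [dp|dp] := pselect (dom d (phi (param c w))).
  have sS := Ck_varied_rep xi Sc Sd phiS (chiS Sc).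
  have oS := open_preimage_Ck (k := 0%N) openT (@Ck_fst _ _ R^o 0 _) (open_chart_domain
    (c := c) (d := d) phiS).
  exists [set z : 'rV[R]_m * R^o | (setT z /\ chart_domain phi c d z.1) /\
      overlap d d' (varied_rep xi phi c d chi z)].
  have oU := open_preimage_Ck oS (sS 0) (@open_overlap _ _ _ d d').
  split.
  - exact: oU.
  - split; first by split=> //; split.
    rewrite overlapE; split.
      by have := eP dp te.
    by move: dw; rewrite variation_dom.
  - apply: (@Ck_congr _ _ _ _ _ (fun z : 'rV[R]_m * R^o => transition d d'
    (varied_rep xi phi c d chi z))).
    + exact: oU.
    + by move=> z [[_ [cz dz]] _]; rewrite variation_dom.
    apply: (Ck_comp oU (@open_overlap _ _ _ d d')).
    + by move=> z [].
    + by apply: Ck_sub (sS k) => z [].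
    + exact: (smooth_onP _ _).1 (transition_smooth Sd Sd') k.
have Kp : ~ K (param c w) by move=> /KD.
pose U0 := [set v | img c v /\ (~` K `&` phi @^-1` dom d') (param c v)].
have oU0 : open U0.
  apply: open_chart_preimage; apply: openI; first by rewrite openC.
  by apply: open_phi_preimage; exact: open_dom.
have oU := open_preimage_Ck (k := 0%N) openT (@Ck_fst _ _ R^o 0 _) oU0.
exists [set z : 'rV[R]_m * R^o | setT z /\ U0 z.1]; split.
- exact: oU.
- by split=> //; split=> //; split=> //; move: dw; rewrite variation_notK.
- apply: (@Ck_congr _ _ _ _ _ (fun z : 'rV[R]_m * R^o => local_rep phi c d' z.1)).
  + exact: oU.
  + by move=> z [_ [cz [Kz dz]]]; rewrite variation_notK.
  apply: (Ck_comp oU (open_chart_domain (c := c) (d := d') phiS)).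
  + by move=> z [_ [cz [Kz dz]]]; split.
  + exact: Ck_fst.
  + exact: Ck_map_rep Sc Sd' phiS k.
Qed.

End Variation.

Lemma jacobian_affine (R : realType) m n (f F : 'rV[R]_m -> 'rV[R]_n) (t : R) x :
  differentiable f x -> differentiable F x ->
  differentiable (fun w => f w + t *: F w) x /\
  'J (fun w => f w + t *: F w) x = 'J f x + t *: 'J F x.
Proof.
move=> df dF; have dtF := differentiableZ t dF.
split; first exact: differentiableD df dtF.
apply: eq_mulmx_rV => v.
have -> : v *m ('J f x + t *: 'J F x) = 'd f x v + t *: 'd F x v.
  apply: etrans (mulmxDr v ('J f x) (t *: 'J F x)) _.
  apply: congr2 (mul_jacobian f x v) _.
  apply: etrans (esym (scalemxAr t v ('J F x))) _.
  exact: (congr1 (fun z => t *: z) (mul_jacobian F x v)).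
apply: etrans (mul_jacobian _ x v) _; apply: etrans (congr1 (@^~ v) (diffD df dtF)) _.
exact: (congr1 (fun z => 'd f x v + z) (congr1 (@^~ v) (diffZ t dF))).
Qed.

Lemma continuous_pair_cst (X Y Z : topologicalType) (f : X -> Y) (x : X) (z : Z) :
  {for x, continuous f} -> {for x, continuous (fun q => (f q, z))}.
Proof.
move=> fc P /= [[A B] [/= nA nB] AB]; have fA := fc A nA.
have : nbhs x (f @^-1` A) by exact: fA.
by apply: filterS => q Aq; apply: (AB (f q, z)); split=> //=; exact: nbhs_singleton nB.
Qed.

(** Differentiation under the integral in quantitative form: a first-order error uniform in the
    point integrates to at most that error times the finite total mass. *)
Lemma Rintegral_expansion d (T : measurableType d) (R : realType)
    (mu : {measure set T -> \bar R}) (a b c : T -> R) (t eps : R) :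
  (mu [set: T] < +oo)%E ->
  mu.-integrable [set: T] (EFin \o a) -> mu.-integrable [set: T] (EFin \o b) ->
  mu.-integrable [set: T] (EFin \o c) ->
  (forall p, `|a p - b p - t * c p| <= eps) ->
  `|\int[mu]_p a p - \int[mu]_p b p - t * \int[mu]_p c p| <= eps * fine (mu [set: T]).
Proof.
move=> muT ia ib ic H.
have itc : mu.-integrable [set: T] (EFin \o (fun p => t * c p)).
  by have := integrableZl measurableT t ic; apply: eq_integrable => // p _.
have iab : mu.-integrable [set: T] (EFin \o (fun p => a p - b p)).
  by have := integrableB measurableT ia ib; apply: eq_integrable => // p _.
have iabc : mu.-integrable [set: T] (EFin \o (fun p => a p - b p - t * c p)).
  by have := integrableB measurableT iab itc; apply: eq_integrable => // p _.
have -> : \int[mu]_p a p - \int[mu]_p b p - t * \int[mu]_p c p =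
    \int[mu]_p (a p - b p - t * c p).
  by rewrite RintegralB// RintegralB// RintegralZl.
apply: le_trans (le_normr_Rintegral measurableT iabc) _.
rewrite -Rintegral_cst//; apply: le_Rintegral => //.
  exact: integrable_norm iabc.
apply: measurable_bounded_integrable => //; exists eps; split; first exact: num_real.
move=> D eD p _ /=; apply: le_trans (ltW eD).
rewrite ger0_norm//; exact: le_trans (H p).
Qed.

(** The pointwise error is taken with the denominator [V + 1] because the volume V is only known to
    be nonnegative here. *)
Lemma difference_quotient_bound (R : realType) (I Et E0 t eps V : R) :
  t != 0 -> 0 < eps -> 0 <= V ->
  `|Et - E0 - t * I| <= eps / (V + 1) * `|t| * V ->
  `|I - t^-1 *: ((Et : R^o) - E0)| <= eps.
Proof.
move=> tn0 eps0 V0 HE.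
have -> : I - t^-1 *: ((Et : R^o) - E0) = - t^-1 * (Et - E0 - t * I).
  rewrite /GRing.scale /=; field; exact: tn0.
rewrite normrM normrN normfV ler_pdivrMl ?normr_gt0//.
apply: le_trans HE _; rewrite mulrAC mulrC ler_wpM2l//.
by rewrite mulrAC ler_pdivrMr ?ltr_wpDl// ler_wpM2l ?(ltW eps0)// lerDl.
Qed.

(** * The first variation of the energy *)

Section VariedEnergy.
Variables (R : realType) (m n : nat) (M : ptopologicalType) (N : topologicalType)
  (SM : smooth_manifold R m M) (SN : smooth_manifold R n N)
  (g : riemannian_metric SM) (h : riemannian_metric SN) (xi : vector_field SN)
  (phi : M -> N).
Hypothesis phiS : smooth_map SM SN phi.

(** The charts in the density depend only on p and on the value at p, so two maps with the same germ
    are computed in the same charts. *)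
Lemma near_eq_density (psi : M -> N) p :
  (\forall q \near p, phi q = psi q) ->
  symphonic_density g h psi p = symphonic_density g h phi p.
Proof.
move=> H; rewrite /symphonic_density -(nbhs_singleton H).
have [Sc cp] := chart_atP SM p; have [Sd dp] := chart_atP SN (phi p).
have df := local_rep_differentiable phiS Sc Sd cp dp.
have Hw : \forall w \near coord (chart_at SM p) p,
    local_rep phi (chart_at SM p) (chart_at SN (phi p)) w =
    local_rep psi (chart_at SM p) (chart_at SN (phi p)) w.
  have := near_param cp H; apply: filterS => w.
  by rewrite /local_rep /= => ->.
by rewrite (near_eq_jacobian Hw df).
Qed.

(** With the zero cutoff, regularity of the varied density covers the density of [phi] itself. *)
Lemma density_phi_varied c d p : atlas SM c -> atlas SN d -> dom c p -> dom d (phi p) ->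
  symphonic_density g h phi p = varied_density g h xi phi c d (fun _ => 0) (coord c p, 0).
Proof.
move=> Sc Sd cp dp; have df := local_rep_differentiable phiS Sc Sd cp dp.
rewrite (symphonic_density_chart g h Sc Sd cp dp _ df); last exact: phiS.1.
by rewrite /varied_density /varied_rep /varied_jacobian /= mul0r !scale0r !addr0
  /map_rep /local_rep /= coordK.
Qed.

Lemma smooth_on_cutoff_cst (c : chart R m M) a : smooth_on (img c) (cutoff_rep c (fun _ : M =>
  a)).
Proof. by apply/smooth_onP => k; exact: Ck_cst. Qed.

Lemma continuous_density_phi : continuous (symphonic_density g h phi : M -> R^o).
Proof.
move=> p; have [Sc cp] := chart_atP SM p; have [Sd dp] := chart_atP SN (phi p).
set c := chart_at SM p in Sc cp; set d := chart_at SN (phi p) in Sd dp.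
have H : \forall q \near p, varied_density g h xi phi c d (fun _ => 0) (coord c q, 0 : R^o) =
    symphonic_density g h phi q.
  have oD := open_phi_preimage phiS (open_dom d).
  have H1 := near_dom cp; have H2 : nbhs p (phi @^-1` dom d) by exact: open_nbhs_nbhs.
  by apply: filterS2 H1 H2 => q cq dq; rewrite (density_phi_varied Sc Sd).
apply: (near_eq_continuous H).
apply: (@continuous_comp _ _ _ (fun q => (coord c q, 0 : R^o)) (varied_density g h xi phi c d
  (fun _ => 0))).
  by apply: continuous_pair_cst; exact: coord_continuous.
have U0 := variation_domain0 xi (fun _ => 0) (coord_chart_domain cp dp).
exact: (Ck_cont (Ck_varied_density g h xi Sc Sd phiS (smooth_on_cutoff_cst (c := c) 0) 0) U0).
Qed.

Variables (d : chart R n N) (chi : M -> R) (K : set M).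
Hypotheses (Sd : atlas SN d)
  (chiS : forall c, atlas SM c -> smooth_on (img c) (cutoff_rep c chi))
  (closedK : closed K) (KD : forall p, K p -> dom d (phi p))
  (chiK : forall p, ~ K p -> chi p = 0).
Variable e : R.
Hypotheses (e0 : 0 < e)
  (eP : forall p t, dom d (phi p) -> `|t| < e -> img d (varied_coord xi phi d chi p t)).

Local Notation Phi := (variation xi phi d chi).
Local Notation rho t p := (symphonic_density g h (Phi^~ t) p).

Lemma density_variation_notK p t : ~ K p -> rho t p = symphonic_density g h phi p.
Proof.
move=> Kp; apply: near_eq_density.
by apply: filterS (near_notK closedK Kp) => q Kq; rewrite (variation_notK _ _ _ chiK).
Qed.

Lemma density_variation c p t : atlas SM c -> dom c p -> dom d (phi p) -> `|t| < e ->
  rho t p = varied_density g h xi phi c d chi (coord c p, t).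
Proof.
move=> Sc cp dp te.
have [dv ve] := variation_img eP dp te.
have cPhi : {for p, continuous (Phi^~ t)}.
  apply: (@continuous_comp _ _ _ (fun q => (q, t)) (fun z : M * R => Phi z.1 z.2)).
    by apply: continuous_pair_cst; exact: cvg_id.
  exact: (continuous_variation Sd phiS chiS closedK KD chiK eP te).
have Up := coord_chart_domain cp dp.
have oU := open_chart_domain (c := c) (d := d) phiS.
have d1 : differentiable (map_rep phi c d) (coord c p).
  exact: (@C1_differentiable _ _ _ _ _ _ oU (Ck_map_rep Sc Sd phiS 1) Up).
have d2 : differentiable (fun w => cutoff_rep c chi w *: field_rep xi phi c d w) (coord c p).
  exact: (@C1_differentiable _ _ _ _ _ _ oU (Ck_cutoff_field_rep xi Sc Sd phiS (chiS Sc) 1) Up).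
have [d3 J3] := jacobian_affine t d1 d2.
have H : \forall w \near coord c p,
    map_rep phi c d w + t *: (cutoff_rep c chi w *: field_rep xi phi c d w) =
    local_rep (Phi^~ t) c d w.
  have NU : \forall w \near coord c p, chart_domain phi c d w by exact: open_nbhs_nbhs.
  apply: filterS NU => w [cw dw].
  by rewrite /local_rep /= (variation_img eP dw te).2 scalerA.
have [d4 _] := near_eq_differentiable H d3.
rewrite (symphonic_density_chart g h Sc Sd cp dv cPhi d4) (near_eq_jacobian H d3) J3.
by rewrite ve /varied_density /varied_jacobian varied_coordE.
Qed.

Lemma near_phi_dom p : dom d (phi p) -> nbhs p (phi @^-1` dom d).
Proof.
move=> dp; apply: open_nbhs_nbhs; split=> //.
by apply: (open_phi_preimage phiS); exact: open_dom.
Qed.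

Lemma continuous_density_variation t : `|t| < e -> continuous ((fun p => rho t p) : M -> R^o).
Proof.
move=> te p; have [dp|dp] := pselect (dom d (phi p)); last first.
  have Kp : ~ K p by move=> /KD.
  have H : \forall q \near p, symphonic_density g h phi q = rho t q.
    by apply: filterS (near_notK closedK Kp) => q Kq; rewrite density_variation_notK.
  by apply: (near_eq_continuous H); exact: continuous_density_phi.
have [Sc cp] := chart_atP SM p; set c := chart_at SM p in Sc cp.
have H : \forall q \near p, varied_density g h xi phi c d chi (coord c q, t : R^o) = rho t q.
  by apply: filterS2 (near_dom cp) (near_phi_dom dp) => q cq dq; rewrite (density_variation Sc).
apply: (near_eq_continuous H).
apply: (@continuous_comp _ _ _ (fun q => (coord c q, t : R^o))
  (varied_density g h xi phi c d chi)).
  by apply: continuous_pair_cst; exact: coord_continuous.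
have Ut := variation_domainP eP cp dp te.
exact: (Ck_cont (Ck_varied_density g h xi Sc Sd phiS (chiS Sc) 0) Ut).
Qed.

(** Differentiating in time at a fixed point involves no chart, so the rate is a single function on
    all of M, whose continuity is then checked locally. *)
Definition density_rate (p : M) : R^o := 'D_1 (fun t : R^o => rho t p : R^o) 0.

Local Notation e01 := ((0, 1) : 'rV[R]_m * R^o).

Lemma density_rate_notK p : ~ K p -> density_rate p = 0.
Proof.
move=> Kp.
have E : (fun t : R^o => rho t p : R^o) = cst (symphonic_density g h phi p : R^o).
  by apply/funext => t; exact: density_variation_notK.
exact: (etrans (congr1 (fun f : R^o -> R^o => 'D_1 f 0) E) (derive_cst _ _ _)).
Qed.

Lemma density_rateE c p : atlas SM c -> dom c p -> dom d (phi p) ->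
  density_rate p = 'D_e01 (varied_density g h xi phi c d chi) (coord c p, 0).
Proof.
move=> Sc cp dp.
have Up := variation_domain0 xi chi (coord_chart_domain cp dp).
have DV := Ck_derivable e01 (Ck_varied_density g h xi Sc Sd phiS (chiS Sc) 1) Up.
have := @is_derive_line _ _ _ (varied_density g h xi phi c d chi) (coord c p, 0) e01 0.
rewrite scale0r addr0 => /(_ DV)[_ <-].
apply: near_eq_derive.
have : \forall t \near (0 : R), `|t| < e.
  by apply/nbhs_ballP; exists e => // t; rewrite -ball_normE /ball_ /= sub0r normrN.
apply: filterS => t te; rewrite (density_variation Sc cp dp te); congr varied_density.
by congr (_, _) => /=; rewrite ?scaler0 ?addr0// add0r [_ *: _]mulr1.
Qed.

Lemma continuous_density_rate : continuous density_rate.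
Proof.
move=> p; have [dp|dp] := pselect (dom d (phi p)); last first.
  have Kp : ~ K p by move=> /KD.
  have H : \forall q \near p, 0 = density_rate q.
    by apply: filterS (near_notK closedK Kp) => q Kq; rewrite density_rate_notK.
  by apply: (near_eq_continuous H); exact: cvg_cst.
have [Sc cp] := chart_atP SM p; set c := chart_at SM p in Sc cp.
have H : \forall q \near p,
    'D_e01 (varied_density g h xi phi c d chi) (coord c q, 0 : R^o) = density_rate q.
  by apply: filterS2 (near_dom cp) (near_phi_dom dp) => q cq dq; rewrite (density_rateE Sc).
apply: (near_eq_continuous H).
apply: (@continuous_comp _ _ _ (fun q => (coord c q, 0 : R^o)) ('D_e01
  (varied_density g h xi phi c d chi))).
  by apply: continuous_pair_cst; exact: coord_continuous.
have U0 := variation_domain0 xi chi (coord_chart_domain cp dp).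
exact: (Ck_cont (Ck_derive e01 (Ck_varied_density g h xi Sc Sd phiS (chiS Sc) 1)) U0).
Qed.

Hypothesis cptM : compact [set: M].

(** The local expansions in charts, together with stationarity off K, become uniform in p by
    compactness of M. *)
Lemma density_expansion (eps : R) : 0 < eps ->
  \forall t \near (0 : R), forall p,
    `|rho t p - rho 0 p - t * density_rate p| <= eps * `|t|.
Proof.
move=> eps0.
have := (compact_near_coveringP _).1 cptM R^o (nbhs (0 : R^o))
  (fun t p => `|rho t p - rho 0 p - t * density_rate p| <= eps * `|t : R|) _.
case; last first.
  by move=> r r0 Hr; exists r => // t tr p; exact: Hr.
move=> p _; have [dp|dp] := pselect (dom d (phi p)); last first.
  have Kp : ~ K p by move=> /KD.
  exists (~` K, setT); first by split; [exact: near_notK|exact: filterT].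
  move=> [q t] [/= Kq _]; rewrite !density_variation_notK// density_rate_notK//.
  by rewrite subrr mulr0 subr0 normr0 mulr_ge0// ltW.
have [Sc cp] := chart_atP SM p; set c := chart_at SM p in Sc cp.
have Up := variation_domain0 xi chi (coord_chart_domain cp dp).
have oW := open_variation_domain (xi := xi) Sc Sd phiS (chiS Sc).
have CW := Ck_varied_density g h xi Sc Sd phiS (chiS Sc) 1.
have := near_coord_prod cp (C1_expansion oW CW Up eps0).
move=> [[A B] [/= nA nB] AB].
exists (A `&` (dom c `&` phi @^-1` dom d), B `&` [set t | `|t : R| < e]).
  split => /=.
    by apply: filterI => //; apply: filterI; [exact: near_dom|exact: near_phi_dom].
  apply: filterI => //; apply/nbhs_ballP; exists e => // t.
  by rewrite -ball_normE /ball_ /= sub0r normrN.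
move=> [q t] [/= [Aq [cq dq]] [Bt te]].
rewrite (density_variation Sc cq dq te) (density_variation Sc cq dq) ?normr0//.
by rewrite (density_rateE Sc cq dq); exact: (AB (q, t)).
Qed.

Variable dv : {measure set (borel M) -> \bar R}.
Hypothesis dvP : is_riemannian_measure g dv.

Lemma Rintegral_density_rate : symphonic g h dv phi ->
  \int[dv]_p (density_rate : borel M -> R) p = 0.
Proof.
move=> [_ crit]; have [E1 E2] := crit e Phi
  (smooth_variation_variation Sd phiS chiS closedK KD chiK e0 eP).
(* Criticality says that the derivative of the energy is 0. It remains to show that the difference
   quotients converge to the integral of the rate and to use uniqueness of limits. *)
set I := (\int[dv]_p _); rewrite -E2; apply/esym/cvg_lim => //.
pose V := fine (dv [set: borel M]).
have V0 : 0 <= V by exact: fine_ge0.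
have Vfin : dv [set: borel M] \is a fin_num.
  by rewrite ge0_fin_numE//; exact: (finite_volume dvP cptM).
have iD := continuous_integrable dvP cptM continuous_density_rate.
apply/cvgrPdist_le => eps eps0.
have eps'0 : 0 < eps / (V + 1) by rewrite divr_gt0// ltr_wpDl.
have Hexp := density_expansion eps'0.
have He : \forall t \near (0 : R), `|t| < e.
  by apply/nbhs_ballP; exists e => // t; rewrite -ball_normE /ball_ /= sub0r normrN.
have H : \forall t \near (0 : R), `|t| < e /\ (forall p,
    `|rho t p - rho 0 p - t * density_rate p| <= eps / (V + 1) * `|t|).
  exact: filterI He Hexp.
have : \forall t \near 0^', t != 0 /\ (`|t| < e /\ (forall p,
    `|rho t p - rho 0 p - t * density_rate p| <= eps / (V + 1) * `|t|)).
  by apply: filterS H => t [te Ht] tn0; split.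
apply: filterS => t [tn0 [te Ht]].
have it := continuous_integrable dvP cptM (continuous_density_variation te).
have i0 := continuous_integrable dvP cptM (@continuous_density_variation 0 _).
rewrite normr0 in i0; have {}i0 := i0 e0.
rewrite /= addr0 [t *: 1]mulr1 /symphonic_energy.
have := @Rintegral_expansion _ (borel M) R dv (fun p => rho t p) (fun p => rho 0 p)
  density_rate t _ (finite_volume dvP cptM) it i0 iD Ht.
exact: difference_quotient_bound.
Qed.

End VariedEnergy.

(** * The two terms of the first variation *)

Section Splitting.
Variables (R : realType) (m n : nat) (M : ptopologicalType) (N : topologicalType)
  (SM : smooth_manifold R m M) (SN : smooth_manifold R n N)
  (g : riemannian_metric SM) (h : riemannian_metric SN) (xi : vector_field SN)
  (phi : M -> N).
Hypothesis phiS : smooth_map SM SN phi.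

Definition smooth_function (chi : M -> R) : Prop :=
  forall c, atlas SM c -> smooth_on (img c) (cutoff_rep c chi).

Lemma smooth_functionM chi chi' : smooth_function chi -> smooth_function chi' ->
  smooth_function (fun p => chi p * chi' p).
Proof.
move=> s1 s2 c Sc; apply/smooth_onP => k; apply: (CkM (open_img (c := c))).
  exact: (smooth_onP _ _).1 (s1 c Sc) k.
exact: (smooth_onP _ _).1 (s2 c Sc) k.
Qed.

Lemma smooth_function_onem chi : smooth_function chi -> smooth_function (fun p => 1 - chi p).
Proof.
move=> s1 c Sc; apply/smooth_onP => k.
rewrite (_ : cutoff_rep c _ = fun w => (1 : R) + (-1) * cutoff_rep c chi w : R^o); last first.
  by apply/funext => w; rewrite mulN1r.
apply: (CkD (open_img (c := c))); first exact: Ck_cst.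
apply: (CkM (open_img (c := c))); first exact: Ck_cst.
exact: (smooth_onP _ _).1 (s1 c Sc) k.
Qed.

Definition pulled_lie (c : chart R m M) (d : chart R n N) (p : M) : R :=
  let J := 'J (local_rep phi c d) (coord c p) in
  2 * form_dot (g c (coord c p)) (J *m lie_metric xi h d (coord d (phi p)) *m J^T)
        (J *m h d (coord d (phi p)) *m J^T).

(* [dchi (x) phi^*(xi^flat)] *)
Definition cross_form (c : chart R m M) (d : chart R n N) (chi : M -> R) (p : M) : 'M[R]_m :=
  (gradient (cutoff_rep c chi) (coord c p))^T *m xi d (coord d (phi p))
    *m h d (coord d (phi p)) *m ('J (local_rep phi c d) (coord c p))^T.

Definition cross_term_in (c : chart R m M) (d : chart R n N) (chi : M -> R) (p : M) : R :=
  let J := 'J (local_rep phi c d) (coord c p) in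
  let X := cross_form c d chi p in
  2 * form_dot (g c (coord c p)) (X + X^T) (J *m h d (coord d (phi p)) *m J^T).

Definition cross_term (chi : M -> R) (p : M) : R :=
  cross_term_in (chart_at SM p) (chart_at SN (phi p)) chi p.

Lemma jacobian_transition_refl (c : chart R m M) p : dom c p ->
  'J (transition c c) (coord c p) = 1%:M.
Proof.
move=> cp; have [did Jid] := jacobian_id (coord c p).
rewrite -Jid; apply: near_eq_jacobian => //.
apply: filterS (near_img cp) => w cw; rewrite /transition /=.
by have [_ ->] := imgP cw.
Qed.

Lemma jacobian_change_target c d d' p : atlas SM c -> atlas SN d -> atlas SN d' ->
  dom c p -> dom d (phi p) -> dom d' (phi p) ->
  'J (local_rep phi c d') (coord c p) =
  'J (local_rep phi c d) (coord c p) *m 'J (transition d d') (coord d (phi p)).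
Proof.
move=> Sc Sd Sd' cp dp d'p.
have [_ ->] := local_rep_change Sc Sc Sd Sd' cp cp dp d'p (phiS.1 p)
  (local_rep_differentiable phiS Sc Sd cp dp).
by rewrite (jacobian_transition_refl cp) mul1mx.
Qed.

(** The cross term is algebraic in [xi], h and the Jacobian of [phi], so the transition Jacobian
    enters without being differentiated and cancels through the transformation laws. Cross terms of
    variations made in different charts of N can therefore be added. *)
Lemma cross_term_change c d d' chi p : atlas SM c -> atlas SN d -> atlas SN d' ->
  dom c p -> dom d (phi p) -> dom d' (phi p) ->
  cross_term_in c d chi p = cross_term_in c d' chi p.
Proof.
move=> Sc Sd Sd' cp dp d'p.
have JE := jacobian_change_target Sc Sd Sd' cp dp d'p.
have HE := metric_transition h Sd Sd' dp d'p.
have XE : xi d' (coord d' (phi p)) =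
    xi d (coord d (phi p)) *m 'J (transition d d') (coord d (phi p)).
  by rewrite -[in LHS](transition_coord d' dp);
    exact: (field_change xi Sd Sd' (overlap_coord dp d'p)).
rewrite /cross_term_in /cross_form JE XE.
move: HE; move: ('J (transition d d') _) ('J (local_rep phi c d) _) => D J /= ->.
by rewrite !trmx_mul !mulmxA.
Qed.

Lemma flat_change c c' d d' p : atlas SM c -> atlas SM c' -> atlas SN d -> atlas SN d' ->
  dom c p -> dom c' p -> dom d (phi p) -> dom d' (phi p) ->
  'J (local_rep phi c d) (coord c p) = 0 -> 'J (local_rep phi c' d') (coord c' p) = 0.
Proof.
move=> Sc Sc' Sd Sd' cp c'p dp d'p J0.
have [_ ->] := local_rep_change Sc Sc' Sd Sd' cp c'p dp d'p (phiS.1 p)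
  (local_rep_differentiable phiS Sc Sd cp dp).
by rewrite J0 mulmx0 mul0mx.
Qed.

Lemma near_gradient (f f' : 'rV[R]_m -> R) u : (\forall w \near u, f w = f' w) ->
  gradient f u = gradient f' u.
Proof.
move=> H; apply/rowP => i; rewrite !mxE /partial.
exact: (@near_eq_derive _ _ _ (f : _ -> R^o) (f' : _ -> R^o)).
Qed.

Lemma gradient_cst (a : R) u : gradient (fun _ : 'rV[R]_m => a) u = 0.
Proof. by apply/rowP => i; rewrite !mxE /partial derive_cst. Qed.

Lemma cross_term_gradient0 chi p :
  gradient (cutoff_rep (chart_at SM p) chi) (coord (chart_at SM p) p) = 0 ->
  cross_term chi p = 0.
Proof.
move=> g0; rewrite /cross_term /cross_term_in /cross_form g0 trmx0 !mul0mx trmx0 addr0.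
by rewrite form_dot0l mulr0.
Qed.

Lemma cross_term_near0 chi p : (\forall q \near p, chi q = 0) -> cross_term chi p = 0.
Proof.
move=> H; apply: cross_term_gradient0; have [_ cp] := chart_atP SM p.
rewrite -(gradient_cst 0 (coord (chart_at SM p) p)); apply: near_gradient.
exact: near_param cp H.
Qed.

Lemma cross_term_cst a p : cross_term (fun _ => a) p = 0.
Proof. by apply: cross_term_gradient0; exact: gradient_cst. Qed.

Lemma cross_termD chi chi' p : smooth_function chi -> smooth_function chi' ->
  cross_term (fun q => chi q + chi' q) p = cross_term chi p + cross_term chi' p.
Proof.
move=> s1 s2; have [Sc cp] := chart_atP SM p.
rewrite /cross_term; set c := chart_at SM p in Sc cp *; set d := chart_at SN _.
have gE : gradient (cutoff_rep c (fun q => chi q + chi' q)) (coord c p) =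
    gradient (cutoff_rep c chi) (coord c p) + gradient (cutoff_rep c chi') (coord c p).
  apply/rowP => i; rewrite !mxE /partial.
  have D1 := Ck_derivable (delta_mx 0 i) ((smooth_onP _ _).1 (s1 c Sc) 1%N) (img_coord cp).
  have D2 := Ck_derivable (delta_mx 0 i) ((smooth_onP _ _).1 (s2 c Sc) 1%N) (img_coord cp).
  exact: deriveD D1 D2.
rewrite /cross_term_in -mulrDr -form_dotDl; congr (2 * form_dot _ _ _).
rewrite /cross_form gE [in LHS]linearD /= !mulmxDl linearD /=.
by rewrite addrACA.
Qed.

Lemma density_rate_split d chi K e c p :
  atlas SN d -> smooth_function chi -> closed K ->
  (forall p, K p -> dom d (phi p)) -> (forall p, ~ K p -> chi p = 0) -> 0 < e ->
  (forall p t, dom d (phi p) -> `|t| < e -> img d (varied_coord xi phi d chi p t)) ->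
  atlas SM c -> dom c p -> dom d (phi p) ->
  density_rate g h xi phi d chi p = chi p * pulled_lie c d p + cross_term_in c d chi p.
Proof.
move=> Sd chiS cK KD chiK e0 eP Sc cp dp.
rewrite (density_rateE g h phiS Sd chiS cK KD chiK e0 eP Sc cp dp).
rewrite (varied_density_derive g h xi Sc Sd phiS (chiS c Sc) (coord_chart_domain cp dp)).
have yE : map_rep phi c d (coord c p) = coord d (phi p) by rewrite /map_rep /local_rep /= coordK.
have fE : cutoff_rep c chi (coord c p) = chi p by rewrite /cutoff_rep coordK.
rewrite /field_rep yE fE mulrDr /pulled_lie /cross_term_in mulrCA; congr (_ + _).
Qed.

End Splitting.

(** * Vanishing of the differential *)

Section Flatness.
Variables (R : realType) (m n : nat) (M : ptopologicalType) (N : topologicalType)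
  (SM : smooth_manifold R m M) (SN : smooth_manifold R n N)
  (g : riemannian_metric SM) (h : riemannian_metric SN)
  (dv : {measure set (borel M) -> \bar R}) (xi : vector_field SN) (phi : M -> N) (s : R).
Hypotheses (cptM : compact [set: M]) (dvP : is_riemannian_measure g dv)
  (lie_pos : forall d v, atlas SN d -> img d v -> posdef (s *: lie_metric xi h d v))
  (crit : symphonic g h dv phi).

Let phiS : smooth_map SM SN phi := crit.1.

Definition flat_at (p : M) : Prop :=
  'J (local_rep phi (chart_at SM p) (chart_at SN (phi p))) (coord (chart_at SM p) p) = 0.

Local Notation cross := (cross_term g h xi phi).

(** The properties that survive addition of cutoffs. Continuity and zero integral are recorded for
    the total rate T only, because Q is assembled from pointwise chosen charts; Q carries the sign
    and detects where [dphi] vanishes. *)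
Definition cutoff_good (chi : M -> R) : Prop :=
  exists Q T : M -> R^o, [/\ forall p, T p = Q p + cross chi p, continuous T,
    \int[dv]_p (T : borel M -> R) p = 0,
    forall p, 0 <= s * Q p & forall p, chi p != 0 -> Q p = 0 -> flat_at p].

Lemma pulled_lie_sign c d p : atlas SM c -> atlas SN d -> dom c p -> dom d (phi p) ->
  0 <= s * pulled_lie g h xi phi c d p /\
  (s * pulled_lie g h xi phi c d p = 0 -> flat_at p).
Proof.
move=> Sc Sd cp dp; rewrite /pulled_lie.
set J := 'J _ _; set H := h d _; set G := g c _.
have [t0 t1] := mxtrace_pullback_posdef J (metric_symm g Sc cp) (metric_posdef g Sc cp)
  (metric_symm h Sd dp) (metric_posdef h Sd dp) (lie_pos Sd (img_coord dp)).
have E : s * (2 * form_dot G (J *m lie_metric xi h d (coord d (phi p)) *m J^T) (J *m H *m J^T)) =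
   2 * form_dot G (J *m (s *: lie_metric xi h d (coord d (phi p))) *m J^T) (J *m H *m J^T).
  rewrite mulrCA; congr (2 * _); rewrite -form_dotZl; congr (form_dot _ _ _).
  by rewrite -scalemxAr -scalemxAl.
rewrite E; split; first by rewrite mulr_ge0.
move=> /eqP; rewrite mulf_eq0 pnatr_eq0 /= => /eqP /t1 J0.
have [Sc' c'p] := chart_atP SM p; have [Sd' d'p] := chart_atP SN (phi p).
exact: (flat_change phiS Sc Sc' Sd Sd' cp c'p dp d'p J0).
Qed.

Lemma cutoff_good_local chi d K : atlas SN d -> smooth_function SM chi -> closed K ->
  (forall p, K p -> dom d (phi p)) -> (forall p, ~ K p -> chi p = 0) ->
  (forall p, 0 <= chi p) -> cutoff_good chi.
Proof.
move=> Sd chiS cK KD chiK chi0.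
have [e e0 eP] := ex_variation_time xi Sd phiS chiS cK KD chiK cptM.
(* The value 0 outside the preimage of the chart domain is the right one: such points lie off the
   closed set K, so the rate and the cross term vanish there as well. *)
pose Q p : R^o := if `[< dom d (phi p) >] then
  chi p * pulled_lie g h xi phi (chart_at SM p) d p else 0.
have QE p : density_rate g h xi phi d chi p = Q p + cross chi p.
  rewrite /Q; case: asboolP => [dp|dp].
    have [Sc cp] := chart_atP SM p; have [Sd' d'p] := chart_atP SN (phi p).
    rewrite (density_rate_split g h phiS Sd chiS cK KD chiK e0 eP Sc cp dp).
    by rewrite (cross_term_change g h xi phiS chi Sc Sd Sd' cp dp d'p).
  have Kp : ~ K p by move=> /KD.
  rewrite (density_rate_notK g h xi phiS d cK chiK Kp) cross_term_near0 ?addr0//.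
  by apply: filterS (near_notK cK Kp) => q /chiK.
exists Q, (density_rate g h xi phi d chi); split=> //.
- exact: (continuous_density_rate phiS Sd chiS cK KD chiK e0 eP).
- exact: (Rintegral_density_rate phiS Sd chiS cK KD chiK e0 eP cptM dvP crit).
- move=> p; rewrite /Q; case: asboolP => [dp|_]; last by rewrite mulr0.
  have [Sc cp] := chart_atP SM p.
  by rewrite mulrCA mulr_ge0//; exact: (pulled_lie_sign Sc Sd cp dp).1.
- move=> p chip Qp; move: Qp; rewrite /Q; case: asboolP => [dp /eqP|dp _].
    have [Sc cp] := chart_atP SM p.
    rewrite mulf_eq0 (negbTE chip) /= => /eqP q0.
    by apply: (pulled_lie_sign Sc Sd cp dp).2; rewrite q0 mulr0.
  by move: chip; rewrite chiK ?eqxx// => /KD.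
Qed.

(** Multiplied by s, both sign-definite parts are nonnegative, so they cannot cancel: if their sum
    vanishes, each does. Where the sum of the cutoffs is nonzero, at least one of them is. *)
Lemma cutoff_goodD chi chi' : smooth_function SM chi -> smooth_function SM chi' ->
  s != 0 -> cutoff_good chi -> cutoff_good chi' -> cutoff_good (fun p => chi p + chi' p).
Proof.
move=> s1 s2 sn0 [Q [T [QT cT iT Q0 Qf]]] [Q' [T' [QT' cT' iT' Q'0 Q'f]]].
exists (fun p => Q p + Q' p), (fun p => T p + T' p); split.
- by move=> p; rewrite QT QT' (cross_termD g h xi phi p s1 s2) addrACA.
- by move=> p; apply: continuousD; [exact: cT|exact: cT'].
- have H := @RintegralD _ (borel M) R dv [set: borel M] T T' measurableT
    (continuous_integrable dvP cptM cT) (continuous_integrable dvP cptM cT').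
  by apply: etrans H _; rewrite [X in X + _]iT [X in _ + X]iT' addr0.
- by move=> p; rewrite mulrDr addr_ge0.
- move=> p chip QQ.
  have /eqP : s * Q p + s * Q' p = 0 by rewrite -mulrDr QQ mulr0.
  rewrite paddr_eq0// !mulf_eq0 (negbTE sn0) /= => /andP[/eqP q1 /eqP q2].
  have [c0|c0] := eqVneq (chi p) 0; last exact: Qf.
  by apply: Q'f => //; move: chip; rewrite c0 add0r.
Qed.

Lemma cutoff_good0 : cutoff_good (fun _ => 0).
Proof.
exists (fun _ => 0), (fun _ => 0); split.
- by move=> p; rewrite cross_term_cst addr0.
- by move=> p; exact: cvg_cst.
- by rewrite Rintegral_cst// mul0r.
- by move=> p; rewrite mulr0.
- by move=> p; rewrite eqxx.
Qed.

Definition bump (b : M -> R) : Prop :=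
  [/\ smooth_function SM b, forall p, 0 <= b p <= 1 &
    exists d K, [/\ atlas SN d, closed K, forall p, K p -> dom d (phi p) &
      forall p, ~ K p -> b p = 0]].

Lemma smooth_function_cst a : smooth_function SM (fun _ => a).
Proof. by move=> c _; exact: smooth_on_cutoff_cst. Qed.

Lemma smooth_function_bumps (l : seq (M -> R)) : (forall b, List.In b l -> bump b) ->
  smooth_function SM (fun p => \prod_(b <- l) (1 - b p)).
Proof.
elim: l => [|b l IH] H.
  rewrite (_ : (fun _ => _) = fun _ => 1); first exact: smooth_function_cst.
  by apply/funext => p; rewrite big_nil.
rewrite (_ : (fun _ => _) = fun p => (1 - b p) * \prod_(b <- l) (1 - b p)); last first.
  by apply/funext => p; rewrite big_cons.
apply: smooth_functionM.
  by apply: smooth_function_onem; have [] := H b (or_introl erefl).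
by apply: IH => b' lb'; apply: H; right.
Qed.

(* [f * (1 - prod (1 - b_i))] is the sum of the functions
   [f * (1 - b_1) * ... * (1 - b_(i-1)) * b_i], each supported like [b_i]. *)
Lemma cutoff_good_bumps (l : seq (M -> R)) (f : M -> R) : s != 0 ->
  (forall b, List.In b l -> bump b) -> smooth_function SM f -> (forall p, 0 <= f p) ->
  cutoff_good (fun p => f p * (1 - \prod_(b <- l) (1 - b p))).
Proof.
move=> sn0; elim: l f => [|b l IH] f H fS f0.
  rewrite (_ : (fun _ => _) = fun _ => 0); first exact: cutoff_good0.
  by apply/funext => p; rewrite big_nil subrr mulr0.
have [bS b01 [d [K [Sd cK KD bK]]]] := H b (or_introl erefl).
have Hl b' : List.In b' l -> bump b' by move=> lb'; apply: H; right.
rewrite (_ : (fun _ => _) = fun p => f p * b p + (f p * (1 - b p)) * (1 - \prod_(b <- l)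
  (1 - b p))); last first.
  by apply/funext => p; rewrite big_cons; ring.
have fbS : smooth_function SM (fun p => f p * b p) by exact: smooth_functionM.
have fb'S : smooth_function SM (fun p => f p * (1 - b p)).
  exact: (smooth_functionM fS (smooth_function_onem bS)).
apply: (cutoff_goodD fbS _ sn0).
- exact: (smooth_functionM fb'S (smooth_function_onem (smooth_function_bumps Hl))).
- apply: (cutoff_good_local Sd fbS cK KD).
    by move=> p Kp; rewrite bK ?mulr0.
  by move=> p; rewrite mulr_ge0//; have /andP[] := b01 p.
- apply: (IH _ Hl fb'S) => p.
  by rewrite mulr_ge0// subr_ge0; have /andP[] := b01 p.
Qed.

(** A Euclidean bump is transported through a chart of M and extended by zero. Smoothness of the
    extension rests on the closedness in M of the set carrying the bump. *)
Lemma bump_at (p : M) : exists b : M -> R, bump b /\ \forall q \near p, b q = 1.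
Proof.
have [Sc cp] := chart_atP SM p; have [Sd dp] := chart_atP SN (phi p).
set c := chart_at SM p in Sc cp; set d := chart_at SN (phi p) in Sd dp.
have oU := open_chart_domain (c := c) (d := d) phiS.
have NU : nbhs (coord c p) (chart_domain phi c d).
  by apply: open_nbhs_nbhs; split=> //; exact: coord_chart_domain.
have /nbhs_ballP[r r0 Hr] := NU.
have r0' : 0 < r by [].
(* Halving the radius keeps the closed ball, and not just the open one, inside the chart domain. *)
have r20 : 0 < r / 2 by rewrite divr_gt0.
have [b0 [b0S b001 b01 b0B]] := bump_exists (coord c p) r20.
pose B := closed_ball (coord c p) (r / 2).
have BU : B `<=` chart_domain phi c d.
  move=> u; rewrite /B closed_ballE// /closed_ball_ /= => pu; apply: Hr.
  rewrite -ball_normE /ball_ /=; apply: le_lt_trans pu _; lra.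
have cB : compact B.
  apply: bounded_closed_compact; last exact: closed_ball_closed.
  exists (`|coord c p| + r / 2); split; first exact: num_real.
  move=> D rD u; rewrite /B closed_ballE// /closed_ball_ /= => pu.
  apply: le_trans (ltW rD); rewrite -[u](subKr (coord c p)).
  by apply: le_trans (ler_normB _ _) _; rewrite lerD2l.
pose K := param c @` B.
(* The set is the continuous image of a compact ball in the Hausdorff space M. *)
have cK : closed K.
  apply: compact_closed; first exact: (manifold_hausdorff SM).
  apply: continuous_compact => //; apply: continuous_in_subspaceT => u.
  by rewrite inE => /BU[cu _]; exact: param_continuous.
pose b q : R := if `[< dom c q >] then b0 (coord c q) else 0.
have bE q : dom c q -> b q = b0 (coord c q) by move=> cq; rewrite /b asboolT.
have bK q : ~ K q -> b q = 0.
  move=> Kq; rewrite /b; case: asboolP => // cq; apply/eqP; apply: contra_notT Kq.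
  move=> /b0B; rewrite -ball_normE /ball_ /= => pq; exists (coord c q); last exact: coordK.
  by rewrite /B closed_ballE// /closed_ball_ /= ltW.
exists b; split; last first.
  have := coord_continuous cp b01; have := near_dom cp; apply: filterS2 => q cq.
  by rewrite bE.
split.
- move=> c' Sc'; apply/smooth_onP => k; apply: Ck_local => u cu.
  have [cq|cq] := pselect (dom c (param c' u)).
    exists (overlap c' c); split.
    + exact: open_overlap.
    + by rewrite overlapE.
    apply: (@Ck_congr _ _ _ _ _ (fun w => b0 (transition c' c w) : R^o)).
    + exact: open_overlap.
    + by move=> w; rewrite overlapE => -[_ cw]; rewrite /cutoff_rep bE.
    apply: (Ck_comp_scalar (@open_overlap _ _ _ c' c) openT) (b0S k) => //.
    exact: (smooth_onP _ _).1 (transition_smooth Sc' Sc) k.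
  have Kq : ~ K (param c' u).
    by move=> [w /BU[cw _] wq]; apply: cq; rewrite -wq; exact: (imgP cw).1.
  exists [set w | img c' w /\ (~` K) (param c' w)]; split.
  + by apply: open_chart_preimage; rewrite openC.
  + by split.
  apply: (@Ck_congr _ _ _ _ _ (cst 0 : _ -> R^o)).
  + by apply: open_chart_preimage; rewrite openC.
  + by move=> w [_ Kw]; rewrite /cutoff_rep bK.
  exact: Ck_cst.
- by move=> q; rewrite /b; case: asboolP => // _; rewrite lexx ler01.
- exists d, K; split=> // q [u /BU[cu du] <-].
  exact: du.
Qed.

Lemma flat_everywhere : s != 0 -> forall p, flat_at p.
Proof.
move=> sn0.
(* The filter is generated, for each finite list of bumps, by the set of lists containing it.
   Compactness relative to it extracts a finite list such that every point has a bump equal to 1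
   there. *)
pose F : set_system (seq (M -> R)) := [set P | exists l0,
  (forall b, List.In b l0 -> bump b) /\
  forall l, (forall b, List.In b l0 -> List.In b l) -> P l].
have FF : Filter F.
  split.
  - by exists [::].
  - move=> P Q [l1 [b1 P1]] [l2 [b2 Q2]]; exists (l1 ++ l2); split.
      by move=> b lb; case: (List.in_app_or _ _ _ lb) => [/b1|/b2].
    move=> l ll; split; [apply: P1|apply: Q2] => b lb; apply: ll.
      by apply: List.in_or_app; left.
    by apply: List.in_or_app; right.
  - by move=> P Q PQ [l0 [b0 P0]]; exists l0; split=> // l /P0 /PQ.
have [|l [bl covl]] := (compact_near_coveringP _).1 cptM (seq (M -> R)) F
  (fun l p => exists2 b, List.In b l & b p = 1) FF.
  move=> p _; have [b [bb b1]] := bump_at p.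
  exists ([set q | b q = 1], [set l | List.In b l]) => /=.
    split=> //; exists [:: b]; split; first by move=> b' [<-|].
    by move=> l; apply; left.
  by move=> [q l] /= [bq lb]; exists b.
have good1 : cutoff_good (fun _ => 1).
  have := cutoff_good_bumps sn0 bl (smooth_function_cst 1) (fun _ => ler01).
  congr cutoff_good; apply/funext => p.
  have [b lb bp] := covl l (fun _ => id) p I.
  (* Some bump equals 1 at the point and kills the product. The telescoped sum of cutoffs is
     therefore exactly 1, with no division by a sum of bumps. *)
  suff -> : \prod_(b <- l) (1 - b p) = 0 by rewrite mul1r subr0.
  elim: (l) lb => // b' l' IH [->|lb]; rewrite big_cons.
    by rewrite bp subrr mul0r.
  by rewrite IH ?mulr0.
have [Q [T [QT cT iT Q0 Qf]]] := good1.
(* The cross term of the constant 1 vanishes, so Q inherits continuity and zero integral from T. *)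
have TQ : T = Q by apply/funext => p; rewrite QT cross_term_cst addr0.
rewrite TQ in cT iT.
have cQ' : continuous (fun p => (s : R^o) * Q p : R^o).
  by move=> p; apply: continuousM; [exact: cvg_cst|exact: cT].
have iQ' : \int[dv]_p ((fun p => s * Q p) : borel M -> R) p = 0.
  have H := @RintegralZl _ (borel M) R dv [set: borel M] Q s measurableT
    (continuous_integrable dvP cptM cT).
  by apply: etrans H _; rewrite [X in _ * X]iT mulr0.
move=> p; apply: Qf; first exact: oner_neq0.
have /eqP := Rintegral_eq0_continuous dvP cptM cQ' Q0 iQ' p.
by rewrite mulf_eq0 (negbTE sn0) => /eqP.
Qed.

(** In a coordinate ball, the mean value theorem along segments from the centre makes every
    component of the representative constant; injectivity of the target chart returns this to
    [phi]. *)
Lemma flat_locally_constant p : (forall q, flat_at q) -> \forall q \near p, phi q = phi p.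
Proof.
move=> flat.
have [Sc cp] := chart_atP SM p; have [Sd dp] := chart_atP SN (phi p).
set c := chart_at SM p in Sc cp; set d := chart_at SN (phi p) in Sd dp.
have oU := open_chart_domain (c := c) (d := d) phiS.
have NU : nbhs (coord c p) (chart_domain phi c d).
  by apply: open_nbhs_nbhs; split=> //; exact: coord_chart_domain.
have /nbhs_ballP[r r0 Hr] := NU.
have r0' : 0 < r by [].
have C1 := Ck_map_rep Sc Sd phiS 1.
have J0 w : chart_domain phi c d w -> forall v, 'D_v (map_rep phi c d) w = 0.
  move=> [[q cq <-] dq] v; rewrite coordK// in dq.
  have [Sc' c'q] := chart_atP SM q; have [Sd' d'q] := chart_atP SN (phi q).
  have dy := local_rep_differentiable phiS Sc Sd cq dq.
  rewrite (deriveEjacobian _ dy).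
  by rewrite (flat_change phiS Sc' Sc Sd' Sd c'q cq d'q dq (flat q)) mulmx0.
have yc w : ball (coord c p) r w -> map_rep phi c d w = map_rep phi c d (coord c p).
  move=> Bw; apply/rowP => j; apply/eqP; rewrite -subr_eq0; apply/eqP.
  have Bt t : 0 <= t <= 1 -> chart_domain phi c d (coord c p + t *: (w - coord c p)).
    move=> /andP[t0 t1]; apply: Hr; move: Bw; rewrite -!ball_normE /ball_ /= => Bw.
    rewrite opprD addrA subrr add0r normrN normrZ ger0_norm// distrC in Bw *.
    apply: le_lt_trans Bw; rewrite -[leRHS]mul1r; exact: ler_wpM2r.
  have Cj := (Ck_mxP _ _ oU).1 C1 0 j.
  have [|t t01] := @MVT_dir _ _ (fun u => map_rep phi c d u 0 j : R^o) (coord c p)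
    (w - coord c p).
    move=> t /Bt Ut; split; first exact: (Ck_cont Cj Ut).
    exact: (Ck_derivable _ Cj Ut).
  have -> : coord c p + (w - coord c p) = w by rewrite addrC subrK.
  move=> ->.
  have Dt := Ck_derivable (w - coord c p) C1 (Bt t t01).
  have := J0 _ (Bt t t01) (w - coord c p); rewrite (derive_mx Dt) => /rowP /(_ j).
  by rewrite !mxE.
have NB : \forall q \near p, ball (coord c p) r (coord c q).
  by apply: (coord_continuous cp); apply: open_nbhs_nbhs; split; [exact: ball_open|exact: ballxx].
have ND : nbhs p (phi @^-1` dom d) by exact: (near_phi_dom phiS dp).
apply: filterS3 NB (near_dom cp) ND => q Bq cq dq.
have := yc _ Bq; rewrite /map_rep /local_rep /= !coordK// => e.
by rewrite -(coordK dq) e coordK.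
Qed.

End Flatness.

(** * Locally constant maps on a connected space, and constancy of symphonic maps *)

Lemma locally_constant_connected (X : topologicalType) (Y : Type) (f : X -> Y) (x0 : X) :
  connected [set: X] -> (forall x, \forall y \near x, f y = f x) ->
  forall x, f x = f x0.
Proof.
move=> cX lf; pose B := [set x | f x = f x0].
have oB : open B.
  rewrite openE => x Bx; apply: filterS (lf x) => y fy.
  by rewrite /B /= fy.
have oCB : open (~` B).
  rewrite openE => x Bx; apply: filterS (lf x) => y fy.
  by rewrite /B /= fy.
have BT : B = [set: X].
  apply: cX.
  - by exists x0.
  - by exists B => //; rewrite setTI.
  - by exists B; rewrite ?setTI// -[B]setCK; rewrite closedC.
by move=> x; have : [set: X] x by []; rewrite -BT.
Qed.

Theorem proposition9 (R : realType) (m n : nat)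
    (M : ptopologicalType) (N : topologicalType)
    (SM : smooth_manifold R m M) (SN : smooth_manifold R n N)
    (g : riemannian_metric SM) (h : riemannian_metric SN)
    (dv : {measure set (borel M) -> \bar R})
    (xi : vector_field SN) (lambda : R) (phi : M -> N) :
  compact [set: M] -> connected [set: M] -> orientable SM ->
  is_riemannian_measure g dv ->
  ricci_soliton h xi lambda -> ~ einstein h ->
  (tensor_lt SN (fun c u => lambda *: h c u) (ricci h) \/
   tensor_lt SN (ricci h) (fun c u => lambda *: h c u)) ->
  symphonic g h dv phi ->
  exists q : N, forall p : M, phi p = q.
Proof.
move=> cptM conM _ dvP sol _ sgn crit.
have lieE d v : atlas SN d -> img d v ->
    lie_metric xi h d v = 2 *: (lambda *: h d v - ricci h d v).
  by move=> Sd dvv; rewrite -(sol d v Sd dvv) addrC addKr scalerA divff ?scale1r.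
have [s sn0 lie_pos] : exists2 s : R, s != 0 &
    forall d v, atlas SN d -> img d v -> posdef (s *: lie_metric xi h d v).
  have q d v w a : atlas SN d -> img d v ->
      (w *m (a *: lie_metric xi h d v) *m w^T) 0 0 =
      a * (2 * ((w *m (lambda *: h d v) *m w^T) 0 0 - (w *m ricci h d v *m w^T) 0 0)).
    move=> Sd dvv; rewrite (lieE d v Sd dvv) scalerA -scalemxAr -scalemxAl mxE.
    by rewrite mulmxBr mulmxBl !mxE mulrA.
  (* If Ric exceeds [lambda h], the Lie derivative is negative definite and [s = -1] reverses it; in
     the other case it is already positive definite. *)
  case: sgn => lt; [exists (-1)|exists 1]; rewrite ?oppr_eq0 ?oner_neq0//.
    move=> d v Sd dvv w w0; rewrite q// mulN1r -mulrN opprB pmulr_rgt0// subr_gt0.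
    exact: lt.
  move=> d v Sd dvv w w0; rewrite q// mul1r pmulr_rgt0// subr_gt0.
  exact: lt.
exists (phi point) => p.
apply: locally_constant_connected => // q.
apply: (flat_locally_constant crit).
exact: (flat_everywhere cptM dvP lie_pos crit sn0).
Qed.
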